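(* For every $n<\omega$ there is a complete dependent theory $T$ in a countable language containing a distinguished unary predicate $P$ such that $T$ has a $(\beth_m,\aleph_0)$-model for every $m<n$, but $T$ has no $(\beth_\omega,\aleph_0)$-model.
   Context: Given a theory $T$ with a distinguished unary predicate $P$ and cardinals $\kappa\geq\lambda\geq\aleph_0$, a $(\kappa,\lambda)$-model of $T$ is a model $M\models T$ with $|M|=\kappa$ and $|P(M)|=\lambda$. $\beth_0=\aleph_0$, $\beth_{m+1}=2^{\beth_m}$, $\beth_\omega=\sup_m\beth_m$. A complete first-order theory is dependent (NIP) if no formula $\varphi(x,y)$ has the independence property, i.e. there is no model containing $\langle a_i: i\in\omega\rangle$ and $\langle b_s: s\subseteq\omega\rangle$ with $\varphi(a_i,b_s)$ holding iff $i\in s$. *)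

(* Defs.v *)
From mathcomp Require Import all_boot.
From mathcomp Require Import boolp classical_sets functions cardinality.

Set Implicit Arguments.
Unset Strict Implicit.
Unset Printing Implicit Defensive.

Local Open Scope classical_set_scope.
Local Open Scope card_scope.

Record language := Language {
  fsym : Type;
  farity : fsym -> nat;
  rsym : Type;
  rarity : rsym -> nat }.

Definition countable_language (L : language) :=
  countable [set: fsym L] /\ countable [set: rsym L].

(* [term L n] and [formula L n] have their free variables among n variables
   indexed by ['I_n]; the quantifier [All] binds the variable of index 0 and
   shifts the other ones. *)
Inductive term (L : language) (n : nat) : Type :=
| Var of 'I_n
| App (f : fsym L) of ('I_(farity f) -> term L n).

Inductive formula (L : language) : nat -> Type :=
| Bot n : formula L n
| Eq n : term L n -> term L n -> formula L n
| Rel n (r : rsym L) : ('I_(rarity r) -> term L n) -> formula L n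
| Imp n : formula L n -> formula L n -> formula L n
| All n : formula L n.+1 -> formula L n.

Definition Not L n (phi : formula L n) : formula L n := Imp phi (Bot L n).

Definition sentence (L : language) := formula L 0.
Definition theory (L : language) := set (sentence L).

Record structure (L : language) := Structure {
  carrier :> Type;
  carrier_inhabited : inhabited carrier;
  fint : forall f : fsym L, ('I_(farity f) -> carrier) -> carrier;
  rint : forall r : rsym L, ('I_(rarity r) -> carrier) -> Prop }.

Fixpoint eval L (M : structure L) n (e : 'I_n -> M) (t : term L n) : M :=
  match t with
  | Var i => e i
  | App f args => fint (fun i => eval e (args i))
  end.

Definition econs (T : Type) n (x : T) (e : 'I_n -> T) : 'I_n.+1 -> T :=
  fun i => if unlift ord0 i is Some j then e j else x.

Fixpoint sat L (M : structure L) n (phi : formula L n) : ('I_n -> M) -> Prop :=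
  match phi in formula _ n return ('I_n -> M) -> Prop with
  | Bot _ => fun _ => False
  | Eq _ t u => fun e => eval e t = eval e u
  | Rel _ r args => fun e => rint (fun i => eval e (args i))
  | Imp _ psi chi => fun e => sat psi e -> sat chi e
  | All _ psi => fun e => forall x : M, sat psi (econs x e)
  end.

Definition holds L (M : structure L) (phi : sentence L) : Prop :=
  forall e : 'I_0 -> M, sat phi e.

Definition model L (T : theory L) (M : structure L) : Prop :=
  forall phi, T phi -> holds M phi.

Definition entails L (T : theory L) (phi : sentence L) : Prop :=
  forall M : structure L, model T M -> holds M phi.

Definition complete_theory L (T : theory L) : Prop :=
  (exists M : structure L, model T M) /\
  (forall phi : sentence L, entails T phi \/ entails T (Not phi)).

Definition ecat (T : Type) p q (a : 'I_p -> T) (b : 'I_q -> T) :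
    'I_(p + q) -> T :=
  fun i => match fintype.split i with inl j => a j | inr j => b j end.

(* In phi(x; y), x and y are tuples of variables, of lengths p and q. *)
Definition independence_property L (T : theory L) p q
    (phi : formula L (p + q)) : Prop :=
  exists (M : structure L) (a : nat -> 'I_p -> M) (b : set nat -> 'I_q -> M),
    model T M /\ forall i s, sat phi (ecat (a i) (b s)) <-> s i.

Definition dependent L (T : theory L) : Prop :=
  forall p q (phi : formula L (p + q)), ~ independence_property T phi.

(* A cardinal is represented by a type of that cardinality. *)
Fixpoint beth (m : nat) : Type := if m is k.+1 then set (beth k) else nat.

(* The supremum of the cardinals [beth m], represented by their disjoint union;
   see [beth_omega_sup]. *)
Definition beth_omega : Type := {m : nat & beth m}.

(* Only meaningful when P is unary. *)
Definition pred_set L (M : structure L) (P : rsym L) : set M :=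
  [set x | rint (fun _ : 'I_(rarity P) => x)].
Arguments pred_set {L} M P.

Definition two_cardinal_model L (T : theory L) (P : rsym L)
    (kappa lambda : Type) (M : structure L) : Prop :=
  [/\ model T M, [set: M] #= [set: kappa] & pred_set M P #= [set: lambda] ].

Lemma card_le_injP (T U : Type) :
  ([set: T] #<= [set: U]) <-> exists f : T -> U, injective f.
Proof.
split=> [/card_leP[f]|[f f_inj]].
  exists (fun x => val (f (to_setT x))) => x y /val_inj.
  by move/(inj (mem_set I) (mem_set I)) => /(congr1 val).
suff /injfunPex[g] : exists2 f : T -> U,
    set_fun [set: T] [set: U] f & set_inj [set: T] f.
  exact: inj_card_le.
by exists f => // x y _ _ /f_inj.
Qed.

Lemma beth_le k m : k <= m -> exists f : beth k -> beth m, injective f.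
Proof.
move=> /subnK <-; elim: (m - k) => [|d [f f_inj]]; first by exists id.
exists (fun x => [set f x] : beth (d.+1 + k)) => x y xy; apply: f_inj.
by have : [set f y] (f x) by rewrite -xy.
Qed.

Definition beth_pt m : beth m := if m is k.+1 then @set0 (beth k) else 0.

Lemma beth_pair m : exists J : nat * beth m -> beth m, injective J.
Proof.
elim: m => [|m [J J_inj]]; first by exists pickle; exact: (pcan_inj pickleK).
exists (fun p => [set J (0, b) | b in p.2] `|` [set J (p.1.+1, b) | b in setT]).
have sub k s k' s' : [set J (0, b) | b in s] `|` [set J (k.+1, b) | b in setT]
    `<=` [set J (0, b) | b in s'] `|` [set J (k'.+1, b) | b in setT] ->
    k = k' /\ s `<=` s'.
  move=> h; split.
    have [|[b _ /J_inj[]]//|[b _ /J_inj[]//]] := h (J (k.+1, (beth_pt m))).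
    by right; exists (beth_pt m).
  move=> b sb; have [|[c s'c /J_inj[<-]]//|[c _ /J_inj[]//]] := h (J (0, b)).
  by left; exists b.
move=> [k s] [k' s'] /= e.
have [|-> ss'] := sub k s k' s'; first by rewrite e.
have [|_ s's] := sub k' s' k s; first by rewrite e.
by congr pair; exact/seteqP.
Qed.

Lemma beth_avoid (X : Type) (F : forall k, beth k -> X) m :
    (forall k, injective (F k)) ->
  exists g : beth m -> beth m.+1, injective g /\
    forall b k (z : beth k), k <= m -> F k z <> F m.+1 (g b).
Proof.
move=> F_inj; have [J J_inj] := beth_pair m.
pose h (s : set (nat * beth m)) (b : beth m) : beth m.+1 :=
  [set J (0, b)] `|` [set J (p.1.+1, p.2) | p in s].
have h_sub s b s' b' : h s b `<=` h s' b' -> b = b' /\ s `<=` s'.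
  move=> hh; split.
    by have [|/J_inj[]//|[p _ /J_inj[]//]] := hh (J (0, b)); left.
  move=> [k y] sp.
  have [|/J_inj[]//|[[k' y'] s'p /J_inj[<- <-]//]] := hh (J (k.+1, y)).
  by right; exists (k, y).
have h_inj s b s' b' : h s b = h s' b' -> b = b' /\ s = s'.
  move=> e; have [|-> ss'] := h_sub s b s' b'; first by rewrite e.
  have [|_ s's] := h_sub s' b' s b; first by rewrite e.
  by split=> //; exact/seteqP.
pose D (p : nat * beth m) (l : beth p.1 -> beth m) (s : set (nat * beth m)) :=
  exists b z, l z = p.2 /\ F p.1 z = F m.+1 (h s b).
have [lift liftP] : {lift : forall k, beth k -> beth m |
    forall k, k <= m -> injective (lift k)}.
  have liftE k : exists f : beth k -> beth m, k <= m -> injective f.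
    have [/beth_le[f f_inj]|_] := leqP k m; first by exists f.
    by exists (fun=> beth_pt m).
  exists (fun k => sval (cid (liftE k))) => k; exact: svalP (cid (liftE k)).
pose s : set (nat * beth m) :=
  [set p | forall s', D p (@lift p.1) s' -> ~ s' p].
exists (h s); split=> [b b' /h_inj[]//|b k z km Fz].
have Ds : D (k, lift k z) (@lift k) s by exists b, z.
have Ns : ~ s (k, lift k z) by move=> ss; exact: (ss s Ds ss).
apply: Ns => s' [b' [z' /= [/(liftP _ km) -> Fz']]].
by move: Fz'; rewrite Fz => /F_inj /h_inj[_ <-] ss; exact: (ss s Ds ss).
Qed.

Lemma beth_omega_sup :
  (forall m, [set: beth m] #<= [set: beth_omega]) /\
  (forall X : Type, (forall m, [set: beth m] #<= [set: X]) ->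
    [set: beth_omega] #<= [set: X]).
Proof.
split=> [m|X leX].
  apply/card_le_injP; exists (existT beth m) => x y.
  exact: (@existT_inj2 nat beth).
have [F F_inj] : {F : forall k, beth k -> X | forall k, injective (F k)}.
  pose Q k := {f : beth k -> X | injective f}.
  have Q_ k : Q k by apply/cid/card_le_injP/leX.
  by exists (fun k => sval (Q_ k)) => k; exact: svalP (Q_ k).
pose g m := cid (beth_avoid m F_inj).
have g_inj m : injective (sval (g m)) by case: (svalP (g m)).
have g_avoid m b k (z : beth k) : k <= m -> F k z <> F m.+1 (sval (g m) b).
  by case: (svalP (g m)) => _; exact.
apply/card_le_injP; exists (fun p => F _ (sval (g (tag p)) (tagged p))).
move=> [k x] [m y] /= e; case: (ltngtP k m) => [km|mk|km].
- by case: (g_avoid _ _ _ _ km e).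
- by case: (g_avoid _ _ _ _ mk (esym e)).
- by case: _ / km in y e *; move: e => /F_inj /g_inj ->.
Qed.

(* Main.v *)
(**
A model consists of finitely many sorts S_0, ..., S_n, each with a dense linear
order and with P = S_0.  For j < n the sort S_{j+1} is the set of branches of a
binary tree whose levels are the points of S_j; only the level dist(x, y) at
which two branches split is part of the structure.  A branch is determined by
the choices it makes at the levels, so |S_{j+1}| <= 2^|S_j|, and a model with P
countable has size at most beth_n.  Unlike the membership relation between
points and sets, the splitting level does not create the independence property.

The axioms say that all spheres {y in S_{j+1} | dist(y, a) = l} are dense for
the order of S_{j+1}.  This makes the order and the tree of a sort independent
of each other and gives a back-and-forth system between finite substructures
that are closed under dist, whence completeness.  A point together with its
splitting levels adds at most n+1 points to a finite closed set of size N, each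
with polynomially many possible types, whereas the independence property would
require 2^N types.

For a model with S_n of size beth_n, let S_j be the set of nonempty words over
int x Y_j, where Y_j is a well-order of size beth_j.  A word w of S_{j+1} gives
a subset of S_j with well-ordered support, that is, a branch: its last letter
codes an arbitrary node (hence density of spheres), and above that node it
repeats cofinally a subset of Y_j that determines w.  Smaller models are Skolem
hulls.
*)
Require Import Defs.
From mathcomp Require Import all_boot ssralg ssrnum ssrint.
From mathcomp Require Import boolp classical_sets functions cardinality wochoice.
From mathcomp Require Import zify.

Set Implicit Arguments.
Unset Strict Implicit.
Unset Printing Implicit Defensive.

Local Open Scope classical_set_scope.
Local Open Scope card_scope.

(** * Back and forth between tree structures *)

(* [dist x y l]: the branches [x] and [y] split at level [l], so larger levels
   mean closer points. *)
Record tree_structure := TreeStructure {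
  pt :> Type;
  srt : nat -> pt -> Prop;
  lt : pt -> pt -> Prop;
  dist : pt -> pt -> pt -> Prop }.

(** Sort 0 carries no tree, so there spheres impose nothing and the [sphere_] axioms only ask for a
    dense order without endpoints; at sort [i.+1] the radii are the points of sort [i]. *)
Definition sphere (M : tree_structure) j (y a l : M) : Prop :=
  if j is _.+1 then dist y a l else True.
Definition radius (M : tree_structure) j (l : M) : Prop :=
  if j is i.+1 then srt i l else True.

(** [dist_binary] makes the branching binary: two distinct points that leave [y] at the same level
    part only at a later one. The [sphere_] axioms also guarantee that every point is left by others
    at every level of the preceding sort. *)
Record tree_axioms (n : nat) (M : tree_structure) : Prop := TreeAxioms {
  srt_ex : forall x : M, exists2 j, j <= n & srt j x;
  srt_uniq : forall i j (x : M), srt i x -> srt j x -> i = j;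
  lt_srt : forall j (x y : M), lt x y -> srt j x <-> srt j y;
  lt_irr : forall x : M, ~ lt x x;
  lt_trans : forall x y z : M, lt x y -> lt y z -> lt x z;
  lt_total : forall j (x y : M), srt j x -> srt j y -> [\/ x = y, lt x y | lt y x];
  dist_srt : forall j (x y l : M), dist x y l -> srt j l -> srt j.+1 x /\ srt j.+1 y;
  dist_irr : forall x l : M, ~ dist x x l;
  dist_sym : forall x y l : M, dist x y l -> dist y x l;
  dist_fun : forall x y l m : M, dist x y l -> dist x y m -> l = m;
  dist_total : forall j (x y : M), srt j.+1 x -> srt j.+1 y ->
    x = y \/ exists l, dist x y l;
  dist_ultra : forall x y z l m : M,
    dist x y l -> dist y z m -> lt l m -> dist x z l;
  dist_binary : forall x y z l : M, dist x y l -> dist y z l ->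
    x = z \/ exists2 m, dist x z m & lt l m;
  srt_inh : forall j, j <= n -> exists x : M, srt j x;
  sphere_dense : forall j (u v a l : M), j <= n -> srt j u -> lt u v ->
    srt j a -> radius j l -> exists y, [/\ lt u y, lt y v & sphere j y a l];
  sphere_above : forall j (u a l : M), j <= n -> srt j u ->
    srt j a -> radius j l -> exists2 y, lt u y & sphere j y a l;
  sphere_below : forall j (v a l : M), j <= n -> srt j v ->
    srt j a -> radius j l -> exists2 y, lt y v & sphere j y a l }.

Lemma finite_maximal (R : nat -> nat -> Prop) (Q : nat -> Prop) k :
  (forall i, ~ R i i) -> (forall a b c, R a b -> R b c -> R a c) ->
  (exists2 i, i < k & Q i) ->
  exists i, [/\ i < k, Q i & forall h, h < k -> Q h -> ~ R i h].
Proof.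
move=> irr tr; elim: k => [|k IH] [i]; first by rewrite ltn0.
rewrite ltnS leq_eqVlt => ik Qi.
have [/IH[m [mk Qm maxm]]|none] := pselect (exists2 i, i < k & Q i).
  have [[Qk Rmk]|nRmk] := pselect (Q k /\ R m k).
    exists k; split=> // h; rewrite ltnS leq_eqVlt => /orP[/eqP -> _|hk Qh Rkh].
      exact: irr.
    exact: (maxm _ hk Qh (tr _ _ _ Rmk Rkh)).
  exists m; split=> //; first exact: ltnW.
  move=> h; rewrite ltnS leq_eqVlt => /orP[/eqP -> Qk Rmk|]; last exact: maxm.
  exact: nRmk.
case/orP: ik => [/eqP ik|ik]; last by case: none; exists i.
exists i; rewrite ik ltnSn; split=> //; first by rewrite -ik.
move=> h; rewrite ltnS leq_eqVlt => /orP[/eqP -> _|hk Qh _]; first exact: irr.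
by apply: none; exists h.
Qed.

Lemma ltnS_cases i k : i < k.+1 -> i = k \/ i < k.
Proof. by rewrite ltnS leq_eqVlt => /orP[/eqP|]; [left|right]. Qed.

(** * Closed tuples and the codes of their one-point extensions *)

Section Streams.
Variables (n : nat) (M : tree_structure).
Hypothesis Mtree : tree_axioms n M.
Implicit Types (e : nat -> M) (x : M) (c : nat -> nat).

(* Finite tuples are streams [e : nat -> M] read below an index [k]. *)
Definition closed k e := forall i h l, i < k -> h < k ->
  dist (e i) (e h) l -> exists2 g, g < k & l = e g.

Definition agree T k (e e' : nat -> T) := forall i, i < k -> e i = e' i.

Definition upd T k (e : nat -> T) (x : T) i := if i < k then e i else x.

Lemma agree_upd T k (e : nat -> T) (y : T) : agree k (upd k e y) e.
Proof. by move=> i; rewrite /upd => ->. Qed.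

Lemma agree_sym T k (e e' : nat -> T) : agree k e e' -> agree k e' e.
Proof. by move=> ee i /ee. Qed.

Lemma agree_trans T k h (e e' e2 : nat -> T) : k <= h ->
  agree k e e' -> agree h e' e2 -> agree k e e2.
Proof. by move=> kh ee ee2 i ik; rewrite ee // ee2 // (leq_trans ik). Qed.

Lemma agree_closed k e e' : agree k e e' -> closed k e -> closed k e'.
Proof.
move=> ee cl i h l ik hk; rewrite -!ee // => /cl[]// g gk ->.
by exists g => //; exact: ee.
Qed.

Definition down_cut k e u i := u < k /\ (e i = e u \/ lt (e i) (e u)).
Definition up_cut k e v i := v < k /\ (e i = e v \/ lt (e v) (e i)).

(* [e h] is the distance to [e i] from a point that leaves [e a] at level [e l]
   and is further away from all the other entries. *)
Definition branch k e a l i h := [/\ a < k, l < k &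
  dist (e a) (e i) (e h) /\ lt (e h) (e l) \/
  e h = e l /\ (e i = e a \/
    exists2 g, g < k & dist (e a) (e i) (e g) /\ lt (e l) (e g))].

(* The isomorphism type of a one-point closed extension [x] of the first [k]
   entries of [e]: either [x] is the entry [c 0], or it has sort [c 1], lies
   just above [c 2] and just below [c 3] and leaves [c 4] at level [c 5];
   an index that is at least [k] stands for "none". *)
Record fresh_code k e x c : Prop := FreshCode {
  fresh_far : k <= c 0;
  fresh_srt : srt (c 1) x;
  fresh_neq : forall i, i < k -> e i <> x;
  fresh_above : forall i, i < k -> lt (e i) x <-> down_cut k e (c 2) i;
  fresh_below : forall i, i < k -> lt x (e i) <-> up_cut k e (c 3) i;
  fresh_dist : forall i h, i < k -> h < k ->
    dist x (e i) (e h) <-> branch k e (c 4) (c 5) i h;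
  fresh_closed : forall i l, i < k -> dist x (e i) l ->
    exists2 g, g < k & l = e g }.

Definition code k e x c := c 0 < k /\ x = e (c 0) \/ fresh_code k e x c.

Lemma lt_maximal e (Q : nat -> Prop) k : (exists2 i, i < k & Q i) ->
  exists i, [/\ i < k, Q i & forall h, h < k -> Q h -> ~ lt (e i) (e h)].
Proof.
apply: (finite_maximal (R := fun i h => lt (e i) (e h))) => [i|a b c ab bc].
- exact: (lt_irr Mtree).
- exact: (lt_trans Mtree ab bc).
Qed.

Lemma lt_minimal e (Q : nat -> Prop) k : (exists2 i, i < k & Q i) ->
  exists i, [/\ i < k, Q i & forall h, h < k -> Q h -> ~ lt (e h) (e i)].
Proof.
apply: (finite_maximal (R := fun i h => lt (e h) (e i))) => [i|a b c ba cb].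
- exact: (lt_irr Mtree).
- exact: (lt_trans Mtree cb ba).
Qed.

Lemma dist_srtP j x y l : dist x y l -> srt j.+1 x -> srt j.+1 y /\ srt j l.
Proof.
move=> xyl jx; have [i _ il] := srt_ex Mtree l.
have [ix iy] := dist_srt Mtree xyl il.
by have [] := srt_uniq Mtree ix jx => <-.
Qed.

Lemma dist_srt_pos x y l : dist x y l -> exists j,
  [/\ srt j.+1 x, srt j.+1 y & srt j l].
Proof.
move=> xyl; have [i _ il] := srt_ex Mtree l.
by have [ix iy] := dist_srt Mtree xyl il; exists i.
Qed.

Lemma dist_neq_level x y l : dist x y l -> l <> x /\ l <> y.
Proof.
move=> /dist_srt_pos[j [jx jy jl]]; split=> E; move: jx jy; rewrite -E => jx jy.
- by have /eqP := srt_uniq Mtree jx jl; rewrite gtn_eqF.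
- by have /eqP := srt_uniq Mtree jy jl; rewrite gtn_eqF.
Qed.

(** Such a point is located by its cut among the entries together with one nearest entry, the
    ultrametric laws giving its other distances. The bound on [c] keeps the number of codes
    polynomial in [k], as the count for dependence requires. *)
Lemma code_ex k e x :
  closed k e -> (forall i l, i < k -> dist x (e i) l ->
    exists2 g, g < k & l = e g) ->
  exists c, (forall t, c t <= maxn n k) /\ code k e x c.
Proof.
move=> cl xcl.
have [[i ik xi]|xnew] := pselect (exists2 i, i < k & x = e i).
  exists (fun=> i); split; last by left.
  by move=> _; rewrite leq_max (ltnW ik) orbT.
have [j jn jx] := srt_ex Mtree x.
have {xnew} xnew i : i < k -> e i <> x by move=> ik E; apply: xnew; exists i.
(* [u] indexes the largest entry below [x]; the value [k] stands for none. *)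
have [u [ku uP]] : exists u, u <= k /\ forall i, i < k ->
    lt (e i) x <-> down_cut k e u i.
  have [/(lt_maximal e)[u [uk ux umax]]|none] :=
      pselect (exists2 i, i < k & lt (e i) x); last first.
    exists k; split=> // i ik; split=> [ix|[]]; last by rewrite ltnn.
    by case: none; exists i.
  exists u; split=> [|i ik]; first exact: ltnW.
  split=> [ix|[_ [->//|iu]]]; last exact: (lt_trans Mtree iu ux).
  split=> //; have ji := (lt_srt Mtree j ix).2 jx.
  have ju := (lt_srt Mtree j ux).2 jx.
  by have [||/(umax _ ik ix)] := lt_total Mtree ji ju; [left|right|].
have [v [kv vP]] : exists v, v <= k /\ forall i, i < k ->
    lt x (e i) <-> up_cut k e v i.
  have [/(lt_minimal e)[v [vk vx vmax]]|none] :=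
      pselect (exists2 i, i < k & lt x (e i)); last first.
    exists k; split=> // i ik; split=> [ix|[]]; last by rewrite ltnn.
    by case: none; exists i.
  exists v; split=> [|i ik]; first exact: ltnW.
  split=> [ix|[_ [->//|iu]]]; last exact: (lt_trans Mtree vx iu).
  split=> //; have ji := (lt_srt Mtree j ix).1 jx.
  have jv := (lt_srt Mtree j vx).1 jx.
  by have [|/(vmax _ ik ix)|] := lt_total Mtree ji jv; [left| |right].
(* [l] indexes the largest, hence closest, level at which [x] leaves an entry, and [a] an entry left
   there. The distances to the other entries follow by comparing them with [e a]. *)
have [a [l [ka kl aP]]] : exists a l, [/\ a <= k, l <= k &
  forall i h, i < k -> h < k ->
    dist x (e i) (e h) <-> branch k e a l i h].
  have [/(lt_maximal e)[l [lk [a ak xal] lmax]]|none] :=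
      pselect (exists2 h, h < k & exists2 i, i < k & dist x (e i) (e h));
    last first.
    exists k, k; split=> // i h ik hk; split=> [ih|[]]; last by rewrite ltnn.
    by case: none; exists h => //; exists i.
  exists a, l; split; [exact: ltnW|exact: ltnW|] => i h ik hk.
  have axl := dist_sym Mtree xal.
  split=> [xih|[_ _ [[aih hl]|[-> [->//|[g gk [aig lg]]]]]]].
  - split=> //; have [i' [ix ii ih]] := dist_srt_pos xih.
    have [_ il] := dist_srtP xal ix.
    have [hl|hl|lh] := lt_total Mtree ih il.
    + right; split=> //; move: xih; rewrite hl => xil.
      have [->|[m aim lm]] := dist_binary Mtree axl xil; first by left.
      by right; have [g gk gm] := cl _ _ _ ak ik aim; exists g; rewrite -?gm.
    + left; split=> //.
      apply: (dist_sym Mtree).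
      exact: (dist_ultra Mtree (dist_sym Mtree xih) xal hl).
    + by case: (lmax _ hk _ lh); exists i.
  - apply: (dist_sym Mtree).
    exact: (dist_ultra Mtree (dist_sym Mtree aih) axl hl).
  - exact: (dist_ultra Mtree xal aig lg).
(* The value [k] at index 0 marks [x] as a new point; as the default it also respects the bound. *)
exists (fun t => nth k [:: k; j; u; v; a; l] t); split.
  by do 6?[case=> [|]] => //=; try move=> t; rewrite leq_max ?leqnn ?orbT ?jn//;
    rewrite ?ku ?kv ?ka ?kl ?orbT //; rewrite nth_nil leqnn orbT.
by right; split.
Qed.

(** [upd] repeats [x] from index [k] on, so nothing new appears at later lengths; hence the claim
    for every [h] from [k] on. *)
Lemma closed_ext k e x : closed k e ->
  (forall i l, i < k -> dist x (e i) l -> exists2 g, g < k & l = e g) ->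
  forall h, k <= h -> closed h (upd k e x).
Proof.
move=> cl xcl h kh i i' l; rewrite /upd => ih i'h.
have up g : g < k -> exists2 g', g' < h & e g = (if g' < k then e g' else x).
  by move=> gk; exists g; rewrite ?gk // (leq_trans gk).
case: ltnP => ik; case: ltnP => i'k; last by move/(dist_irr Mtree).
- by move=> /cl[]// g /up[g' g'h ->] ->; exists g'.
- by move=> /(dist_sym Mtree)/xcl[]// g /up[g' g'h ->] ->; exists g'.
- by move=> /xcl[]// g /up[g' g'h ->] ->; exists g'.
Qed.

(* The closure of a tuple and a new point is obtained by adding the branching
   level of the point first; this lowers the sort. *)
Lemma add_point_srt j k e x : srt j x -> closed k e ->
  exists e', [/\ agree k e' e, forall h, k <= h -> closed h e',
    forall h, k <= h -> exists2 i, i <= j & srt i (e' h) &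
    exists2 i, i < k + j.+1 & e' i = x].
Proof.
elim: j k e x => [|j IH] k e x jx cl.
  exists (upd k e x); split; first exact: agree_upd.
  - apply: closed_ext => // i l _ /dist_srt_pos[j [j1x _ _]].
    by have := srt_uniq Mtree j1x jx.
  - by move=> h kh; exists 0; rewrite // /upd ltnNge kh.
  - by exists k; rewrite /upd ?addn1 ?ltnn.
have [xd|none] := pselect (exists2 i, i < k & exists l, dist x (e i) l); last first.
  exists (upd k e x); split; first exact: agree_upd.
  - by apply: closed_ext => // i l ik xil; case: none; exists i => //; exists l.
  - by move=> h kh; exists j.+1; rewrite // /upd ltnNge kh.
  - by exists k; rewrite /upd ?ltnn // addnS ltnS leq_addr.
(* [e a] is an entry nearest to [x]; its level [l] is the one that has to be added before [x]. *)
have [a [ak [l al] amax]] : exists a, [/\ a < k, exists l, dist x (e a) l &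
    forall h, h < k -> (exists l, dist x (e h) l) -> ~ exists l m,
      [/\ dist x (e a) l, dist x (e h) m & lt l m]].
  move: xd; apply: finite_maximal => [i [l [m [il im]]]|b b' b''].
    by rewrite (dist_fun Mtree il im); exact: (lt_irr Mtree).
  move=> [l1 [l2 [d1 d2 l12]]] [l3 [l4 [d3 d4 l34]]]; exists l1, l4; split=> //.
  by rewrite (dist_fun Mtree d3 d2) in l34; exact: (lt_trans Mtree l12 l34).
have [_ jl] := dist_srtP al jx.
have [e1 [e1e cl1 srt1 [i0 i0k e1l]]] := IH k e l jl cl.
(* New entries have sort at most [j], too low to be at a distance from [x]. An old entry splits from
   [x] either at [l] or, being further away, at the level where it splits from [e a]. *)
have xcl i m : i < k + j.+1 -> dist x (e1 i) m ->
    exists2 g, g < k + j.+1 & m = e1 g.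
  move=> ikj xim; have [ik|ki] := ltnP i k; last first.
    have [i' i'j ii'] := srt1 _ ki; have [ji _] := dist_srtP xim jx.
    by have E := srt_uniq Mtree ii' ji; move: i'j; rewrite E ltnn.
  rewrite e1e // in xim; have [_ jm] := dist_srtP xim jx.
  have [ml|ml|lm] := lt_total Mtree jm jl.
  - by exists i0; rewrite // e1l.
  - have iam := dist_ultra Mtree (dist_sym Mtree xim) al ml.
    have [g gk ->] := cl _ _ _ ik ak iam.
    by exists g; [rewrite (leq_trans gk) // leq_addr|rewrite e1e].
  - by case: (amax i ik); [exists m|exists l, m].
exists (upd (k + j.+1) e1 x); split.
- by move=> i ik; rewrite agree_upd ?e1e // (leq_trans ik) // leq_addr.
- move=> h kh; have [hk|] := ltnP h (k + j.+1); last first.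
    by apply: closed_ext => //; apply: cl1; exact: leq_addr.
  apply: agree_closed (cl1 _ kh); apply: agree_sym => i ih.
  by rewrite agree_upd // (ltn_trans ih).
- move=> h kh; rewrite /upd; case: ltnP => _; last by exists j.+1.
  by have [i ij ?] := srt1 _ kh; exists i => //; exact: ltnW.
- by exists (k + j.+1); rewrite /upd ?ltnn // !addnS ltnS.
Qed.

Lemma add_point k e x : closed k e -> exists e', [/\ agree k e' e,
  forall h, k <= h -> closed h e' & exists2 i, i < k + n.+1 & e' i = x].
Proof.
move=> cl; have [j jn jx] := srt_ex Mtree x.
have [e' [e'e cl' _ [i ik e'x]]] := add_point_srt jx cl.
by exists e'; split=> //; exists i => //; rewrite (leq_trans ik) // leq_add2l.
Qed.

(** The growth is linear in the number [t] of added points; [r] records at which index each of them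
    ends up. *)
Lemma add_points (t : nat) (x : nat -> M) k e : closed k e ->
  exists e' (r : nat -> nat), [/\ agree k e' e, forall h, k <= h -> closed h e' &
    forall s, s < t -> r s < k + t * n.+1 /\ e' (r s) = x s].
Proof.
move=> cl; elim: t => [|t [e1 [r1 [e1e cl1 r1P]]]].
  exists (upd k e (e 0)), (fun=> 0); split=> //; first exact: agree_upd.
  apply: closed_ext => // i l ik; apply: cl => //.
  exact: leq_trans ik.
have kt := leq_addr (t * n.+1) k.
have [e2 [e2e1 cl2 [i ik e2x]]] := add_point (x t) (cl1 _ kt).
exists e2, (fun s => if s == t then i else r1 s); split.
- exact: agree_trans (fun i ik => e2e1 i (leq_trans ik kt)) e1e.
- move=> h kh; have [hk|] := ltnP h (k + t * n.+1); last exact: cl2.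
  apply: agree_closed (cl1 _ kh) => g gh.
  by rewrite e2e1 // (ltn_trans gh).
- move=> s; rewrite ltnS mulSnr addnA; case: eqVneq => [->//|nst] st.
  have {st} st : s < t by rewrite ltn_neqAle nst.
  have [r1s <-] := r1P s st; split; last exact: e2e1.
  by rewrite (leq_trans r1s) // leq_addr.
Qed.

End Streams.


(** * Partial isomorphisms of closed tuples and their extension *)

Record piso (M N : tree_structure) k (e : nat -> M) (e' : nat -> N) : Prop :=
  Piso {
  piso_eq : forall i h, i < k -> h < k -> e i = e h <-> e' i = e' h;
  piso_srt : forall j i, i < k -> srt j (e i) <-> srt j (e' i);
  piso_lt : forall i h, i < k -> h < k -> lt (e i) (e h) <-> lt (e' i) (e' h);
  piso_dist : forall i h g, i < k -> h < k -> g < k ->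
    dist (e i) (e h) (e g) <-> dist (e' i) (e' h) (e' g);
  piso_closed : closed k e;
  piso_closed' : closed k e' }.

Lemma piso_sym (M N : tree_structure) k (e : nat -> M) (e' : nat -> N) :
  piso k e e' -> piso k e' e.
Proof.
case=> Ieq Isrt Ilt Idist cl cl'; split=> //.
- by move=> i h ik hk; rewrite Ieq.
- by move=> j i ik; rewrite Isrt.
- by move=> i h ik hk; rewrite Ilt.
- by move=> i h g ik hk gk; rewrite Idist.
Qed.

Lemma piso_agree (M N : tree_structure) k (e e1 : nat -> M) (e' e1' : nat -> N) :
  agree k e e1 -> agree k e' e1' -> piso k e e' -> piso k e1 e1'.
Proof.
move=> E E' [Ieq Isrt Ilt Idist cl cl']; split.
- by move=> i h ik hk; rewrite -!E -?E' //; exact: Ieq.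
- by move=> j i ik; rewrite -E -?E' //; exact: Isrt.
- by move=> i h ik hk; rewrite -!E -?E' //; exact: Ilt.
- by move=> i h g ik hk gk; rewrite -!E -?E' //; exact: Idist.
- exact: agree_closed cl.
- exact: agree_closed cl'.
Qed.

Lemma down_cut_piso (M N : tree_structure) k (e : nat -> M) (e' : nat -> N) u i :
  piso k e e' -> i < k -> down_cut k e u i <-> down_cut k e' u i.
Proof.
move=> I ik; split=> -[uk]; rewrite ?(piso_eq I ik uk) ?(piso_lt I ik uk) //.
by rewrite -(piso_eq I ik uk) -(piso_lt I ik uk).
Qed.

Lemma up_cut_piso (M N : tree_structure) k (e : nat -> M) (e' : nat -> N) v i :
  piso k e e' -> i < k -> up_cut k e v i <-> up_cut k e' v i.
Proof.
move=> I ik; split=> -[vk]; rewrite ?(piso_eq I ik vk) ?(piso_lt I vk ik) //.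
by rewrite -(piso_eq I ik vk) -(piso_lt I vk ik).
Qed.

Lemma branch_piso (M N : tree_structure) k (e : nat -> M) (e' : nat -> N) a l i h :
  piso k e e' -> i < k -> h < k -> branch k e a l i h <-> branch k e' a l i h.
Proof.
have imp (M1 N1 : tree_structure) (e1 : nat -> M1) (e1' : nat -> N1) :
    piso k e1 e1' -> i < k -> h < k -> branch k e1 a l i h -> branch k e1' a l i h.
  move=> I ik hk [ak lk D]; split=> //; case: D => [[d lhl]|[E D]].
    by left; split; [apply/(piso_dist I)|apply/(piso_lt I)].
  right; split; first exact/(piso_eq I).
  case: D => [E'|[g gk [d lt_lg]]]; first by left; exact/(piso_eq I).
  by right; exists g => //; split; [apply/(piso_dist I)|apply/(piso_lt I)].
by move=> I ik hk; split; apply: imp => //; exact: piso_sym.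
Qed.

Section BackAndForth.
Variables (n : nat) (M N : tree_structure).
Hypotheses (Mtree : tree_axioms n M) (Ntree : tree_axioms n N).
Implicit Types e : nat -> M.

Lemma fresh_code_closed (L : tree_structure) k (e : nat -> L) c :
  tree_axioms n L -> closed k e -> fresh_code k e (e k) c -> closed k.+1 e.
Proof.
move=> Lt cl F; have := closed_ext Lt cl (fresh_closed F) (leqnSn k).
apply: agree_closed => i; rewrite ltnS leq_eqVlt /upd.
by case/orP=> [/eqP ->|->]; rewrite ?ltnn.
Qed.

(** A level has smaller sort than the points it separates, so the new point is no level for itself,
    and the levels between old entries are old by closedness. *)
Lemma fresh_code_level (L : tree_structure) k (e : nat -> L) c i h :
  tree_axioms n L -> closed k e -> fresh_code k e (e k) c ->
  i < k.+1 -> h < k.+1 -> ~ dist (e i) (e h) (e k).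
Proof.
move=> Lt cl F /ltnS_cases[->|ik]; first by move=> _ /(dist_neq_level Lt)[].
case/ltnS_cases=> [->|hk]; first by move/(dist_neq_level Lt)=> [].
by move/cl => /(_ ik hk)[g gk] /esym; exact: fresh_neq F _ gk.
Qed.

(** A code determines all atomic relations between the last entry and the earlier ones, so equal
    codes preserve the isomorphism. *)
Lemma code_ext k e (e' : nat -> N) c : piso k e e' ->
  code k e (e k) c -> code k e' (e' k) c -> piso k.+1 e e'.
Proof.
move=> I [[zk Ez]|F] [[zk' Ez']|F'].
- have dup i : i < k.+1 -> exists i', [/\ i' < k, e i = e i' & e' i = e' i'].
    rewrite ltnS leq_eqVlt => /orP[/eqP ->|ik]; last by exists i.
    by exists (c 0).
  split.
  + move=> i h /dup[i' [ik -> ->]] /dup[h' [hk -> ->]]; exact: (piso_eq I).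
  + move=> j i /dup[i' [ik -> ->]]; exact: (piso_srt I).
  + move=> i h /dup[i' [ik -> ->]] /dup[h' [hk -> ->]]; exact: (piso_lt I).
  + move=> i h g /dup[i' [ik -> ->]] /dup[h' [hk -> ->]] /dup[g' [gk -> ->]].
    exact: (piso_dist I).
  + move=> i h l /dup[i' [ik -> _]] /dup[h' [hk -> _]] /(piso_closed I ik hk).
    by case=> g gk ->; exists g => //; exact: ltnW.
  + move=> i h l /dup[i' [ik _ ->]] /dup[h' [hk _ ->]] /(piso_closed' I ik hk).
    by case=> g gk ->; exists g => //; exact: ltnW.
- by have := fresh_far F'; rewrite leqNgt zk.
- by have := fresh_far F; rewrite leqNgt zk'.
have cl := piso_closed I; have cl' := piso_closed' I.
split.
- move=> i h /ltnS_cases[->|ik] /ltnS_cases[->|hk] //.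
  + by split=> /esym E; [case: (fresh_neq F hk E)|case: (fresh_neq F' hk E)].
  + by split=> E; [case: (fresh_neq F ik E)|case: (fresh_neq F' ik E)].
  + exact: (piso_eq I).
- move=> j i /ltnS_cases[->|ik]; last exact: (piso_srt I).
  have Fs := fresh_srt F; have Fs' := fresh_srt F'.
  by split=> [/(srt_uniq Mtree Fs) <-|/(srt_uniq Ntree Fs') <-].
- move=> i h /ltnS_cases[->|ik] /ltnS_cases[->|hk].
  + by split=> [/(lt_irr Mtree)|/(lt_irr Ntree)].
  + by rewrite (fresh_below F hk) (fresh_below F' hk); exact: up_cut_piso.
  + by rewrite (fresh_above F ik) (fresh_above F' ik); exact: down_cut_piso.
  + exact: (piso_lt I).
- have symE (L : tree_structure) (x y l : L) : tree_axioms n L ->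
    dist x y l <-> dist y x l by move=> Lt; split; exact: (dist_sym Lt).
  move=> i h g ik hk /ltnS_cases[->|gk].
    have := @fresh_code_level M k e c i h Mtree cl F ik hk.
    by have := @fresh_code_level N k e' c i h Ntree cl' F' ik hk.
  move: ik hk => /ltnS_cases[->|ik] /ltnS_cases[->|hk].
  + by split=> [/(dist_irr Mtree)|/(dist_irr Ntree)].
  + by rewrite (fresh_dist F hk gk) (fresh_dist F' hk gk); exact: branch_piso.
  + rewrite (symE M _ _ _ Mtree) (symE N _ _ _ Ntree).
    by rewrite (fresh_dist F ik gk) (fresh_dist F' ik gk); exact: branch_piso.
  + exact: (piso_dist I).
- exact: fresh_code_closed Mtree cl F.
- exact: fresh_code_closed Ntree cl' F'.
Qed.

(** A code amounts to one interval and one sphere, and the density axioms of [N] provide a point in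
    both. All other distances then follow from the ultrametric laws. *)
Lemma code_realize k e (e' : nat -> N) x c : piso k e e' -> code k e x c ->
  exists x', code k e' x' c.
Proof.
move=> I [[zk _]|F]; first by exists (e' (c 0)); left.
set j := c 1; set u := c 2; set v := c 3; set a := c 4; set l := c 5.
have jx : srt j x := fresh_srt F.
have jn : j <= n by have [j' j'n] := srt_ex Mtree x; move/(srt_uniq Mtree jx) => ->.
have cmp i : i < k -> srt j (e i) -> lt (e i) x \/ lt x (e i).
  move=> ik ji; have [/(fresh_neq F ik)[]|?|?] := lt_total Mtree ji jx; by [left|right].
have [x' [jx' ux' x'v ax']] : exists x' : N, [/\ srt j x',
    u < k -> lt (e' u) x', v < k -> lt x' (e' v) &
    a < k -> l < k -> dist x' (e' a) (e' l)].
  have uP : u < k -> lt (e u) x /\ srt j (e' u).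
    move=> uk; have ux : lt (e u) x by apply/(fresh_above F uk); split=> //; left.
    by split=> //; apply/(piso_srt I) => //; apply/(lt_srt Mtree _ ux).
  have vP : v < k -> lt x (e v) /\ srt j (e' v).
    move=> vk; have vx : lt x (e v) by apply/(fresh_below F vk); split=> //; left.
    by split=> //; apply/(piso_srt I) => //; apply/(lt_srt Mtree _ vx).
  have aP : a < k -> l < k -> exists j', [/\ j = j'.+1, srt j (e' a) & srt j' (e' l)].
    move=> ak lk; have xal : dist x (e a) (e l).
      by apply/(fresh_dist F ak lk); split=> //; right; split=> //; left.
    have [j' [j'x j'a j'l]] := dist_srt_pos Mtree xal.
    have E := srt_uniq Mtree jx j'x; exists j'; rewrite E.
    by split=> //; apply/(piso_srt I).
  have nbr i : i < k -> srt j (e i) -> u < k \/ v < k.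
    move=> ik ji; case: (cmp i ik ji) => [/(fresh_above F ik)[]|/(fresh_below F ik)[]];
      by [left|right].
  (* Any entry of sort [j] above 0 splits from [x] at a level in the tuple, so the code does name a
     nearest entry and a level; at sort 0, where spheres are trivial, [e' i] serves as center and as
     radius. *)
  have branching i : i < k -> srt j (e i) -> exists a' l' : N,
      [/\ srt j a', radius j l' & forall y, sphere j y a' l' ->
         a < k -> l < k -> dist y (e' a) (e' l)].
    move=> ik ji; case Ej: j => [|j'].
      exists (e' i), (e' i); split=> //.
        by apply/(piso_srt I) => //; rewrite -Ej.
      by move=> y _ ak lk; have [j' []] := aP ak lk; rewrite Ej.
    have [/esym/(fresh_neq F ik)[]|[m xim]] := dist_total Mtree
      (eq_ind _ (fun j => srt j x) jx _ Ej) (eq_ind _ (fun j => srt j (e i)) ji _ Ej).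
    have [h hk Em] := fresh_closed F ik xim; rewrite {}Em in xim.
    have /(fresh_dist F ik hk)[ak lk _] := xim.
    have [j1 [jj1 ja jl]] := aP ak lk.
    exists (e' a), (e' l); split=> //; first by rewrite -Ej.
    by move: jj1; rewrite Ej => -[->].
  have [uk|uk] := ltnP u k; have [vk|vk] := ltnP v k.
  - have [ux ju] := uP uk; have [xv jv] := vP vk.
    have ju1 : srt j (e u) by apply/(piso_srt I).
    have [a' [l' [ja' jl' nearP]]] := branching u uk ju1.
    have uv : lt (e' u) (e' v) by apply/(piso_lt I) => //; exact: (lt_trans Mtree ux xv).
    have [y [uy yv yP]] := sphere_dense Ntree jn ju uv ja' jl'.
    exists y; split=> //; first by apply/(lt_srt Ntree _ uy).
    exact: nearP.
  - have [ux ju] := uP uk.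
    have ju1 : srt j (e u) by apply/(piso_srt I).
    have [a' [l' [ja' jl' nearP]]] := branching u uk ju1.
    have [y uy yP] := sphere_above Ntree jn ju ja' jl'.
    exists y; split=> //; first by apply/(lt_srt Ntree _ uy).
    exact: nearP.
  - have [xv jv] := vP vk.
    have jv1 : srt j (e v) by apply/(piso_srt I).
    have [a' [l' [ja' jl' nearP]]] := branching v vk jv1.
    have [y yv yP] := sphere_below Ntree jn jv ja' jl'.
    exists y; split=> //; first by apply/(lt_srt Ntree _ yv).
    exact: nearP.
  (* With no neighbor on either side the tuple has no entry of sort [j], so any point of that sort
     will do. *)
  - have [y jy] := srt_inh Ntree jn; exists y; split=> // ak lk.
    have [_ [_ ja _]] := aP ak lk; have ja1 : srt j (e a) by apply/(piso_srt I).
    by have [] := nbr a ak ja1; rewrite ltnNge ?uk ?vk.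
exists x'; right.
have above i : i < k -> lt (e i) x -> lt (e' i) x'.
  move=> ik /(fresh_above F ik)/(down_cut_piso _ I ik)[uk [->|iu]]; first exact: ux'.
  exact: (lt_trans Ntree iu (ux' uk)).
have below i : i < k -> lt x (e i) -> lt x' (e' i).
  move=> ik /(fresh_below F ik)/(up_cut_piso _ I ik)[vk [->|vi]]; first exact: x'v.
  exact: (lt_trans Ntree (x'v vk) vi).
have cmp' i : i < k -> srt j (e' i) -> lt (e i) x \/ lt x (e i).
  by move=> ik ji; apply: cmp => //; apply/(piso_srt I).
have branch' i h : i < k -> h < k -> dist x (e i) (e h) -> dist x' (e' i) (e' h).
  move=> ik hk /(fresh_dist F ik hk)/(branch_piso _ _ I ik hk)[ak lk].
  have x'al := ax' ak lk.
  case=> [[aih hl]|[-> [->//|[g gk [aig lg]]]]].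
    apply: (dist_sym Ntree).
    exact: (dist_ultra Ntree (dist_sym Ntree aih) (dist_sym Ntree x'al) hl).
  exact: (dist_ultra Ntree x'al aig lg).
(* Distances are unique, so [x'] has no distances besides those copied from [x] by [branch']. *)
have closed' i m : i < k -> dist x' (e' i) m ->
    exists h, [/\ h < k, m = e' h & dist x (e i) (e h)].
  move=> ik x'im; have [j' [j'x j'i _]] := dist_srt_pos Ntree x'im.
  have Ej := srt_uniq Ntree j'x jx'.
  have [/esym/(fresh_neq F ik)[]|[m' xim']] := dist_total Mtree
    (eq_ind_r (fun j => srt j x) jx Ej) ((piso_srt I _ ik).2 j'i).
  have [h hk Em'] := fresh_closed F ik xim'; rewrite Em' in xim'.
  exists h; split=> //; exact: (dist_fun Ntree x'im (branch' _ _ ik hk xim')).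
split=> //.
- exact: fresh_far F.
- move=> i ik E; have ji : srt j (e' i) by rewrite E.
  by case: (cmp' i ik ji) => [/(above i ik)|/(below i ik)]; rewrite E => /(lt_irr Ntree).
- move=> i ik; rewrite -(down_cut_piso _ I ik) -(fresh_above F ik).
  split=> [ix'|]; last exact: above.
  have ji : srt j (e' i) by apply/(lt_srt Ntree _ ix').
  case: (cmp' i ik ji) => // /(below i ik) x'i.
  by have /(lt_irr Ntree) := lt_trans Ntree ix' x'i.
- move=> i ik; rewrite -(up_cut_piso _ I ik) -(fresh_below F ik).
  split=> [ix'|]; last exact: below.
  have ji : srt j (e' i) by apply/(lt_srt Ntree _ ix').
  case: (cmp' i ik ji) => // /(above i ik) x'i.
  by have /(lt_irr Ntree) := lt_trans Ntree ix' x'i.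
- move=> i h ik hk; rewrite -(branch_piso _ _ I ik hk) -(fresh_dist F ik hk).
  split=> [x'ih|]; last exact: branch'.
  have [g [gk Eg xig]] := closed' _ _ ik x'ih.
  by have -> : e h = e g by apply/(piso_eq I).
- by move=> i m ik /(closed' i m ik)[h [hk -> _]]; exists h.
Qed.

Lemma code_of_closed (L : tree_structure) k (e : nat -> L) :
  tree_axioms n L -> closed k e -> closed k.+1 e ->
  exists c, (forall t, c t <= maxn n k) /\ code k e (e k) c.
Proof.
move=> Lt cl cl1; apply: code_ex => // i l ik d.
have [g] := cl1 _ _ _ (ltnSn k) (leqW ik) d.
rewrite ltnS leq_eqVlt => /orP[/eqP -> E|]; last by exists g.
by have [] := dist_neq_level Lt d.
Qed.

Lemma piso_refl (L : tree_structure) k (e e1 : nat -> L) :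
  agree k e e1 -> closed k e -> piso k e e1.
Proof.
move=> E cl; split=> //; try by move=> *; rewrite !E.
exact: agree_closed cl.
Qed.

Lemma agree_code (L : tree_structure) k (e e1 : nat -> L) x c :
  agree k e e1 -> closed k e -> code k e x c -> code k e1 x c.
Proof.
move=> E cl; have I := piso_refl E cl.
case=> [[zk Ez]|F]; first by left; rewrite -E.
right; case: F => far js neq above below d xcl; split=> //.
- by move=> i ik; rewrite -E //; exact: neq.
- by move=> i ik; rewrite -E // -(down_cut_piso _ I) //; exact: above.
- by move=> i ik; rewrite -E // -(up_cut_piso _ I) //; exact: below.
- by move=> i h ik hk; rewrite -!E // -(branch_piso _ _ I) //; exact: d.
- by move=> i l ik; rewrite -E // => /xcl[]// g gk ->; exists g; rewrite ?E.
Qed.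

(** The points of a whole closure are matched one at a time, which is possible because every initial
    segment of [e1] from [k] on is closed. *)
Lemma piso_forth k t e (e1 : nat -> M) (e' : nat -> N) : piso k e e' -> agree k e1 e ->
  (forall h, k <= h -> closed h e1) ->
  exists2 e1', agree k e1' e' & piso (k + t) e1 e1'.
Proof.
move=> I e1e cl1; elim: t => [|t [e2 e2e' I2]].
  by exists e' => //; rewrite addn0; apply: piso_agree I => //; exact: agree_sym.
have kt : k <= k + t by exact: leq_addr.
have [c [_ cP]] := code_of_closed Mtree (cl1 _ kt) (cl1 _ (leqW kt)).
have [x' x'P] := code_realize I2 cP.
have I3 : piso (k + t) e1 (upd (k + t) e2 x').
  apply: piso_agree I2 => //; apply: agree_sym; exact: agree_upd.
exists (upd (k + t) e2 x').
  by move=> i ik; rewrite agree_upd ?e2e' // (leq_trans ik).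
rewrite addnS; apply: code_ext I3 cP _.
rewrite {2}/upd ltnn.
apply: agree_code x'P; last exact: piso_closed' I2.
by apply: agree_sym; exact: agree_upd.
Qed.

End BackAndForth.

(** * The theory of tree structures and its completeness *)

Inductive tree_rsym := RLt | RDist | RSort of nat.

Definition tree_language : language :=
  @Language void (fun _ => 0) tree_rsym
    (fun r => match r with RLt => 2 | RDist => 3 | RSort _ => 1 end).

Lemma countable_tree_language : countable_language tree_language.
Proof.
split; first exact: countableP.
apply/card_le_injP; exists (fun r : tree_rsym =>
  match r with RLt => 0 | RDist => 1 | RSort j => j.+2 end).
by move=> [||i] [||j] //= [->].
Qed.

Definition tree_of (M : structure tree_language) : tree_structure :=
  @TreeStructure M
    (fun j x => @rint _ M (RSort j) (fun=> x))
    (fun x y => @rint _ M RLt (fun i : 'I_2 => nth x [:: x; y] i))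
    (fun x y l => @rint _ M RDist (fun i : 'I_3 => nth x [:: x; y; l] i)).

Local Notation o1of2 := (Ordinal (isT : 1 < 2)).
Local Notation o1of3 := (Ordinal (isT : 1 < 3)).
Local Notation o2of3 := (Ordinal (isT : 2 < 3)).

Lemma rint_sort (M : structure tree_language) j f :
  @rint _ M (RSort j) f = srt j (f ord0 : tree_of M).
Proof. by congr rint; apply/funext => i; rewrite (ord1 i). Qed.

Lemma rint_lt (M : structure tree_language) f :
  @rint _ M RLt f = lt (f ord0 : tree_of M) (f o1of2).
Proof.
by congr rint; apply/funext; case=> -[|[|//]] i /=; congr f; exact: val_inj.
Qed.

Lemma rint_dist (M : structure tree_language) f :
  @rint _ M RDist f = dist (f ord0 : tree_of M) (f o1of3) (f o2of3).
Proof.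
by congr rint; apply/funext; case=> -[|[|[|//]]] i /=; congr f; exact: val_inj.
Qed.

Definition term_var k (t : term tree_language k) : 'I_k :=
  match t with Var i => i | App f _ => match f with end end.

Lemma eval_var (M : structure tree_language) k (e : 'I_k -> M) t :
  eval e t = e (term_var t).
Proof. by case: t => [|[]]. Qed.

(** The matched tuple must be closed and so may have more entries than the formula has variables;
    [r] tells which entry each variable names. At a quantifier the closure of the new point is
    added. *)
Lemma sat_piso n k (phi : formula tree_language k) (M N : structure tree_language) :
  tree_axioms n (tree_of M) -> tree_axioms n (tree_of N) ->
  forall s (e : nat -> tree_of M) (e' : nat -> tree_of N) (r : 'I_k -> nat),
  piso s e e' -> (forall i, r i < s) ->
  sat phi (fun i => e (r i) : M) <-> sat phi (fun i => e' (r i) : N).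
Proof.
elim: phi M N => {k} [k|k t u|k rel args|k phi IHphi psi IHpsi|k phi IH] M N
  Mtree Ntree s e e' r I rs //=.
- by rewrite !eval_var; exact: (piso_eq I).
- have -> : (fun i => eval (fun i => e (r i) : M) (args i)) =
      (fun i => e (r (term_var (args i))) : M) by apply/funext => i; rewrite eval_var.
  have -> : (fun i => eval (fun i => e' (r i) : N) (args i)) =
      (fun i => e' (r (term_var (args i))) : N) by apply/funext => i; rewrite eval_var.
  case: rel args => [||j] args; rewrite ?rint_lt ?rint_dist ?rint_sort.
  + exact: (piso_lt I).
  + exact: (piso_dist I).
  + exact: (piso_srt I).
- by rewrite (IHphi M N Mtree Ntree s e e') // (IHpsi M N Mtree Ntree s e e').
have forth (M1 N1 : structure tree_language) (e1 : nat -> tree_of M1)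
    (e1' : nat -> tree_of N1) : tree_axioms n (tree_of M1) ->
    tree_axioms n (tree_of N1) -> piso s e1 e1' ->
    (forall x : N1, sat phi (econs x (fun i => e1' (r i) : N1))) ->
    forall x : M1, sat phi (econs x (fun i => e1 (r i) : M1)).
  move=> M1tree N1tree I1 sat1 x.
  have [e2 [e2e cl [h hs e2x]]] := add_point M1tree x (piso_closed I1).
  have [e2' e2e' I2] := piso_forth M1tree N1tree n.+1 I1 e2e cl.
  have econsE (T : Type) (f f2 : nat -> T) : agree s f2 f ->
      econs (f2 h) (fun i => f (r i)) = (fun i => f2 (econs h r i)).
    move=> ff2; apply/funext => i; rewrite /econs.
    by case: (unlift ord0 i) => // j; rewrite ff2.
  rewrite -e2x (econsE _ _ _ e2e).
  have rh i : econs h r i < s + n.+1.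
    by rewrite /econs; case: (unlift ord0 i) => // j; rewrite (leq_trans (rs j)) // leq_addr.
  apply/(IH M1 N1 M1tree N1tree _ _ _ _ I2 rh).
  by rewrite -(econsE _ _ _ e2e'); exact: sat1.
split; first exact: forth (piso_sym I).
exact: forth I.
Qed.

Lemma tree_elem_equiv n (M N : structure tree_language) (phi : sentence tree_language) :
  tree_axioms n (tree_of M) -> tree_axioms n (tree_of N) ->
  holds M phi -> holds N phi.
Proof.
move=> Mtree Ntree Mphi e.
case: (carrier_inhabited M) (carrier_inhabited N) => x [y].
have I : piso 0 (fun=> x : tree_of M) (fun=> y : tree_of N) by split.
have E T (f g : 'I_0 -> T) : f = g by apply/funext => -[].
have r0 (i : 'I_0) : 0 < 0 by case: i.
rewrite (E _ e (fun=> y)); apply/(sat_piso phi Mtree Ntree I r0).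
exact: Mphi.
Qed.

(** * A syntax with all connectives in which the axioms are written *)

Inductive fm :=
| FTop | FBot | FEq of nat & nat | FLt of nat & nat | FDist of nat & nat & nat
| FSrt of nat & nat | FImp of fm & fm | FAnd of fm & fm | FOr of fm & fm
| FAll of fm | FEx of fm.

Definition scons T (x : T) (v : nat -> T) i := if i is h.+1 then v h else x.

Fixpoint fsat (M : tree_structure) (f : fm) (v : nat -> M) : Prop :=
  match f with
  | FTop => True
  | FBot => False
  | FEq i h => v i = v h
  | FLt i h => lt (v i) (v h)
  | FDist i h g => dist (v i) (v h) (v g)
  | FSrt j i => srt j (v i)
  | FImp a b => fsat a v -> fsat b v
  | FAnd a b => fsat a v /\ fsat b v
  | FOr a b => fsat a v \/ fsat b v
  | FAll a => forall x, fsat a (scons x v)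
  | FEx a => exists x, fsat a (scons x v)
  end.

Fixpoint fwf (k : nat) (f : fm) : bool :=
  match f with
  | FTop | FBot => true
  | FEq i h | FLt i h => (i < k) && (h < k)
  | FDist i h g => [&& i < k, h < k & g < k]
  | FSrt _ i => i < k
  | FImp a b | FAnd a b | FOr a b => fwf k a && fwf k b
  | FAll a | FEx a => fwf k.+1 a
  end.

Definition var k i : term tree_language k.+1 := Var _ (inord i).

(** Variables are plain numbers, cast by [inord]; the values at [k = 0] are placeholders for atoms
    that [fwf] rules out. *)
Fixpoint ftr (f : fm) (k : nat) : formula tree_language k :=
  match f with
  | FTop => Not (Bot _ k)
  | FBot => Bot _ k
  | FEq i h => if k is k'.+1 then Eq (var k' i) (var k' h) else Bot _ _
  | FLt i h => if k is k'.+1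
      then @Rel tree_language _ RLt (fun t : 'I_2 => var k' (nth 0 [:: i; h] t))
      else Bot _ _
  | FDist i h g => if k is k'.+1
      then @Rel tree_language _ RDist (fun t : 'I_3 => var k' (nth 0 [:: i; h; g] t))
      else Bot _ _
  | FSrt j i => if k is k'.+1
      then @Rel tree_language _ (RSort j) (fun t : 'I_1 => var k' i) else Bot _ _
  | FImp a b => Imp (ftr a k) (ftr b k)
  | FAnd a b => Not (Imp (ftr a k) (Not (ftr b k)))
  | FOr a b => Imp (Not (ftr a k)) (ftr b k)
  | FAll a => All (ftr a k.+1)
  | FEx a => Not (All (Not (ftr a k.+1)))
  end.

Lemma sat_ftr (M : structure tree_language) f k (v : nat -> tree_of M) : fwf k f ->
  sat (ftr f k) (fun i => v i : M) <-> fsat f v.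
Proof.
have econsE h (x : M) (w : nat -> tree_of M) :
    econs x (fun i : 'I_h => w i : M) = (fun i => scons x w i).
  by apply/funext => i; rewrite /econs; case: unliftP => [j|] ->.
elim: f k v => [||i h|i h|i h g|j i|a IHa b IHb|a IHa b IHb|a IHa b IHb|a IH|a IH]
  k v //=.
- by case: k => // k /andP[ik hk]; rewrite /= !inordK.
- by case: k => // k /andP[ik hk]; rewrite /= rint_lt /= !inordK.
- by case: k => // k /and3P[ik hk gk]; rewrite /= rint_dist /= !inordK.
- by case: k => // k ik; rewrite /= rint_sort /= !inordK.
- by case/andP=> /IHa -> /IHb ->.
- case/andP=> /IHa -> /IHb ->; split=> [nab|[a1 b1] ab]; last exact: ab.
  by apply: contrapT => nab'; apply: nab => a1 b1; exact: nab'.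
- case/andP=> /IHa -> /IHb ->; split=> [nab|[//|//]].
  by have [|/nab] := pselect (fsat a v); [left|right].
- move=> wf; split=> sa x; last by rewrite econsE; exact/(IH _ _ wf).
  by apply/(IH _ _ wf); rewrite -econsE.
- move=> wf; split=> [na|[x ax] na]; last first.
    by apply: (na x); rewrite econsE; exact/(IH _ _ wf).
  apply: contrapT => nex; apply: na => x; rewrite econsE => /(IH _ _ wf) ax.
  by apply: nex; exists x.
Qed.

Local Notation "a ~> b" := (FImp a b) (at level 60, right associativity).

Definition fsphere j y a l := if j is _.+1 then FDist y a l else FTop.
Definition fradius j l := if j is i.+1 then FSrt i l else FTop.

(* The axioms of [tree_axioms], in the same order. *)
Inductive tree_sentence (n : nat) : fm -> Prop :=
| ASrtEx : tree_sentence n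
    (FAll (foldr FOr FBot [seq FSrt j 0 | j <- iota 0 n.+1]))
| ASrtUniq i j : i != j -> tree_sentence n (FAll (FSrt i 0 ~> FSrt j 0 ~> FBot))
| ALtSrt j : tree_sentence n (FAll (FAll (FLt 1 0 ~>
    FAnd (FSrt j 1 ~> FSrt j 0) (FSrt j 0 ~> FSrt j 1))))
| ALtIrr : tree_sentence n (FAll (FLt 0 0 ~> FBot))
| ALtTrans : tree_sentence n
    (FAll (FAll (FAll (FLt 2 1 ~> FLt 1 0 ~> FLt 2 0))))
| ALtTotal j : tree_sentence n (FAll (FAll (FSrt j 1 ~> FSrt j 0 ~>
    FOr (FEq 1 0) (FOr (FLt 1 0) (FLt 0 1)))))
| ADistSrt j : tree_sentence n (FAll (FAll (FAll (FDist 2 1 0 ~> FSrt j 0 ~>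
    FAnd (FSrt j.+1 2) (FSrt j.+1 1)))))
| ADistIrr : tree_sentence n (FAll (FAll (FDist 1 1 0 ~> FBot)))
| ADistSym : tree_sentence n
    (FAll (FAll (FAll (FDist 2 1 0 ~> FDist 1 2 0))))
| ADistFun : tree_sentence n
    (FAll (FAll (FAll (FAll (FDist 3 2 1 ~> FDist 3 2 0 ~> FEq 1 0)))))
| ADistTotal j : tree_sentence n (FAll (FAll (FSrt j.+1 1 ~> FSrt j.+1 0 ~>
    FOr (FEq 1 0) (FEx (FDist 2 1 0)))))
| ADistUltra : tree_sentence n (FAll (FAll (FAll (FAll (FAll
    (FDist 4 3 1 ~> FDist 3 2 0 ~> FLt 1 0 ~> FDist 4 2 1))))))
| ADistBinary : tree_sentence n (FAll (FAll (FAll (FAll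
    (FDist 3 2 0 ~> FDist 2 1 0 ~>
     FOr (FEq 3 1) (FEx (FAnd (FDist 4 2 0) (FLt 1 0))))))))
| ASrtInh j : j <= n -> tree_sentence n (FEx (FSrt j 0))
| ADense j : j <= n -> tree_sentence n (FAll (FAll (FAll (FAll
    (FSrt j 3 ~> FLt 3 2 ~> FSrt j 1 ~> fradius j 0 ~>
     FEx (FAnd (FLt 4 0) (FAnd (FLt 0 3) (fsphere j 0 2 1))))))))
| AAbove j : j <= n -> tree_sentence n (FAll (FAll (FAll
    (FSrt j 2 ~> FSrt j 1 ~> fradius j 0 ~>
     FEx (FAnd (FLt 3 0) (fsphere j 0 2 1))))))
| ABelow j : j <= n -> tree_sentence n (FAll (FAll (FAll
    (FSrt j 2 ~> FSrt j 1 ~> fradius j 0 ~>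
     FEx (FAnd (FLt 0 3) (fsphere j 0 2 1)))))).

Definition tree_theory n : theory tree_language :=
  fun phi => exists2 f, tree_sentence n f & phi = ftr f 0.

Lemma tree_sentence_wf n f : tree_sentence n f -> fwf 0 f.
Proof.
case=> //=; try by case.
by elim: (iota 1 n) => //= j s ->.
Qed.

Lemma fsat_sphere (M : tree_structure) j y a l (v : nat -> M) :
  fsat (fsphere j y a l) v = sphere j (v y) (v a) (v l).
Proof. by case: j. Qed.

Lemma fsat_radius (M : tree_structure) j l (v : nat -> M) :
  fsat (fradius j l) v = radius j (v l).
Proof. by case: j. Qed.

Lemma fsat_srt_ex (M : tree_structure) n (v : nat -> M) :
  fsat (foldr FOr FBot [seq FSrt j 0 | j <- iota 0 n.+1]) v <->
  exists2 j, j <= n & srt j (v 0).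
Proof.
have -> : (exists2 j, j <= n & srt j (v 0)) <->
    (exists2 j, j \in iota 0 n.+1 & srt j (v 0)).
  by split=> -[j jn jv]; exists j => //; move: jn; rewrite mem_iota add0n.
elim: (iota 0 n.+1) => [|j s IH] /=; first by split=> // -[].
rewrite IH; split=> [[jv|[i iin iv]]|[i]].
- by exists j => //; exact: mem_head.
- by exists i => //; rewrite inE iin orbT.
- by rewrite inE => /orP[/eqP -> jv|iin iv]; [left|right; exists i].
Qed.

Lemma tree_axiomsP (M : tree_structure) n (v : nat -> M) :
  tree_axioms n M <-> forall f, tree_sentence n f -> fsat f v.
Proof.
split=> [Mt f|sats].
- case=> /=.
  + by move=> x; apply/fsat_srt_ex => /=; exact: (srt_ex Mt).
  + by move=> i j ij x ix jx; move/eqP: ij; apply; exact: (srt_uniq Mt ix jx).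
  + by move=> j x y /(lt_srt Mt j)[].
  + exact: (lt_irr Mt).
  + by move=> x y z xy yz; exact: (lt_trans Mt xy yz).
  + by move=> j x y jx jy; have [->|?|?] := lt_total Mt jx jy;
      [left|right; left|right; right].
  + by move=> j x y l xyl jl; exact: (dist_srt Mt xyl jl).
  + by move=> x l; exact: (dist_irr Mt).
  + by move=> x y l; exact: (dist_sym Mt).
  + by move=> x y l m xyl xym; exact: (dist_fun Mt xyl xym).
  + by move=> j x y jx jy; exact: (dist_total Mt jx jy).
  + by move=> x y z l m d1 d2 lm; exact: (dist_ultra Mt d1 d2 lm).
  + move=> x y z l d1 d2; have [->|[m xzm lm]] := dist_binary Mt d1 d2.
      by left.
    by right; exists m.
  + by move=> j jn; have [x jx] := srt_inh Mt jn; exists x.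
  + move=> j jn u v' a l ju uv ja; rewrite fsat_radius /= => jl.
    have [y [uy yv ya]] := sphere_dense Mt jn ju uv ja jl.
    by exists y; rewrite fsat_sphere.
  + move=> j jn u a l ju ja; rewrite fsat_radius /= => jl.
    have [y uy ya] := sphere_above Mt jn ju ja jl.
    by exists y; rewrite fsat_sphere.
  + move=> j jn u a l ju ja; rewrite fsat_radius /= => jl.
    have [y uy ya] := sphere_below Mt jn ju ja jl.
    by exists y; rewrite fsat_sphere.
- split.
  + by move=> x; have /(_ x)/fsat_srt_ex := sats _ (ASrtEx n).
  + move=> i j x ix jx; apply: contrapT => /eqP ij.
    exact: (sats _ (ASrtUniq n ij) x ix jx).
  + by move=> j x y /(sats _ (ALtSrt n j) x y)[].
  + exact: (sats _ (ALtIrr n)).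
  + exact: (sats _ (ALtTrans n)).
  + move=> j x y jx jy; have /=[|[]] := sats _ (ALtTotal n j) x y jx jy.
    * by constructor 1.
    * by constructor 2.
    * by constructor 3.
  + by move=> j x y l; exact: (sats _ (ADistSrt n j) x y l).
  + exact: (sats _ (ADistIrr n)).
  + exact: (sats _ (ADistSym n)).
  + exact: (sats _ (ADistFun n)).
  + by move=> j x y; exact: (sats _ (ADistTotal n j) x y).
  + exact: (sats _ (ADistUltra n)).
  + move=> x y z l d1 d2; have /=[|[m []]] := sats _ (ADistBinary n) x y z l d1 d2.
      by left.
    by right; exists m.
  + by move=> j jn; exact: (sats _ (ASrtInh jn)).
  + move=> [|j] u v' a l jn ju uv ja jl;
    by have [y [uy [yv ya]]] := sats _ (ADense jn) u v' a l ju uv ja jl; exists y.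
  + move=> [|j] u a l jn ju ja jl;
    by have [y [uy ya]] := sats _ (AAbove jn) u a l ju ja jl; exists y.
  + move=> [|j] u a l jn ju ja jl;
    by have [y [uy ya]] := sats _ (ABelow jn) u a l ju ja jl; exists y.
Qed.

Lemma model_tree_theory n (M : structure tree_language) :
  model (tree_theory n) M <-> tree_axioms n (tree_of M).
Proof.
have [x] := carrier_inhabited M; pose v : nat -> tree_of M := fun=> x.
have E (e : 'I_0 -> M) : e = (fun i => v i) by apply/funext => -[].
rewrite (tree_axiomsP n v); split=> [MT f nf|sats phi [f nf ->] e].
- rewrite -(sat_ftr (k := 0)); last exact: tree_sentence_wf nf.
  by apply: MT; exists f.
- by rewrite (E e) sat_ftr; [exact: sats|exact: tree_sentence_wf nf].
Qed.

Lemma complete_tree_theory n (M : structure tree_language) :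
  tree_axioms n (tree_of M) -> complete_theory (tree_theory n).
Proof.
move=> Mt; split; first by exists M; exact/model_tree_theory.
move=> phi; have [Mphi|nMphi] := pselect (holds M phi).
  by left=> N /model_tree_theory Nt; exact: tree_elem_equiv Mt Nt Mphi.
right=> N /model_tree_theory Nt e satphi; apply: nMphi.
by apply: (tree_elem_equiv Nt Mt) => e'; have -> : e' = e by apply/funext => -[].
Qed.

(** * Cardinality bound and dependence *)

(* Label the two halves of every ball of radius [l] by booleans; a point is
   determined by its labels, since two points are separated at their distance. *)
Lemma sort_set_inj n (M : tree_structure) j : tree_axioms n M ->
  exists F : M -> set M, (forall x l, F x l -> srt j l) /\
    forall x y, srt j.+1 x -> srt j.+1 y -> F x = F y -> x = y.
Proof.
move=> Mt.
(* [ball x l] collects the points that split from [x] at [l] or later; those satisfying [near x l]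
   form the half of it that contains [x]. *)
pose ball x l : set M := [set y | y = x \/ exists2 m, dist x y m & l = m \/ lt l m].
(* [ctr] depends only on the set, so points with the same ball are compared with the same center. *)
have [ctr ctrP] : {ctr : set M -> M | forall B, B !=set0 -> B (ctr B)}.
  have E (B : set M) : exists y, B !=set0 -> B y.
    have [[y By]|nB] := pselect (B !=set0); first by exists y.
    have [x _] := srt_inh Mt (leq0n n); by exists x => /nB.
  by have [ctr ctrP] := choice E; exists ctr.
pose near (x l y : M) := x = y \/ exists2 m, dist x y m & lt l m.
exists (fun x => [set l | srt j l /\ near x l (ctr (ball x l))]).
split=> [x l []//|x y jx jy Fxy].
have [//|[l xyl]] := dist_total Mt jx jy.
have yxl := dist_sym Mt xyl.
have [_ jl] := dist_srtP Mt xyl jx.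
have ball_sub x1 y1 : dist x1 y1 l -> ball x1 l `<=` ball y1 l.
  move=> d1 z [->|[m d2 lm]].
    by right; exists l; [exact: (dist_sym Mt)|left].
  case: lm => [E|lm].
    rewrite -E in d2; have := dist_binary Mt (dist_sym Mt d1) d2.
    by case=> [->|[m' d3 lm']]; [left|right; exists m' => //; right].
  right; exists l; last by left.
  by exact: (dist_ultra Mt (dist_sym Mt d1) d2 lm).
have ballE : ball x l = ball y l by apply/seteqP; split; exact: ball_sub.
set c := ctr (ball x l).
have xc : ball x l c by apply: ctrP; exists x; left.
have yc : ball y l c by rewrite -ballE.
have nearE : near x l c <-> near y l c.
  have /propeqP : [set l | srt j l /\ near x l (ctr (ball x l))] l =
    [set l | srt j l /\ near y l (ctr (ball y l))] l by rewrite Fxy.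
  by rewrite /= -ballE -/c; tauto.
have far x1 : ~ near x1 l c -> ball x1 l c -> dist x1 c l.
  move=> nn [E|[m d [->//|lm]]]; first by case: nn; left.
  by case: nn; right; exists m.
have contr z : lt l z -> ~ dist x y z.
  by move=> lz /(dist_fun Mt xyl) E; rewrite E in lz; exact: (lt_irr Mt lz).
(* At their splitting level [x] and [y] share the ball. If both lie in the half of its center, or
   both in the other half, they coincide or split later than [l], which is impossible. *)
have [nx|fx] := pselect (near x l c).
  have ny := nearE.1 nx.
  have noxy m : lt l m -> dist x c m -> False.
    move=> lm d1; have ycl := dist_ultra Mt yxl d1 lm.
    case: ny => [E|[m' d2 lm']]; first by rewrite -E in ycl; exact: (dist_irr Mt ycl).
    rewrite (dist_fun Mt ycl d2) in lm'; exact: (lt_irr Mt lm').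
  case: nx => [E|[m d1 lm]]; last by case: (noxy m).
  rewrite -E in ny; case: ny => [->//|[m d2 lm]].
  by case: (contr m lm); exact: (dist_sym Mt).
have d1 := far x fx xc.
have d2 := far y (fun h => fx (nearE.2 h)) yc.
have [//|[m d3 lm]] := dist_binary Mt d1 (dist_sym Mt d2).
by case: (contr m).
Qed.

Lemma sort_beth n (M : tree_structure) j : tree_axioms n M ->
  (exists f : M -> nat, forall x y, srt 0 x -> srt 0 y -> f x = f y -> x = y) ->
  exists f : M -> beth j, forall x y, srt j x -> srt j y -> f x = f y -> x = y.
Proof.
move=> Mt f0; elim: j => // j [f f_inj].
have [F [Fj F_inj]] := sort_set_inj j Mt.
exists (fun x => f @` F x) => x y jx jy E; apply: F_inj => //.
have sub u v : f @` F u = f @` F v -> F u `<=` F v.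
  move=> Euv l Ful; have : (f @` F u) (f l) by exists l.
  by rewrite Euv => -[m Fvm] /f_inj <- //; [exact: Fj Fvm|exact: Fj Ful].
by apply/seteqP; split; apply: sub.
Qed.

Lemma tree_beth n (M : tree_structure) : tree_axioms n M ->
  (exists f : M -> nat, forall x y, srt 0 x -> srt 0 y -> f x = f y -> x = y) ->
  exists f : M -> beth n, injective f.
Proof.
move=> Mt f0; have [J J_inj] := beth_pair n.
have [F F_inj] : {F : nat -> M -> beth n | forall j x y, j <= n ->
    srt j x -> srt j y -> F j x = F j y -> x = y}.
  have E j : exists f : M -> beth n, forall x y, j <= n ->
      srt j x -> srt j y -> f x = f y -> x = y.
    have [jn|_] := leqP j n; last by exists (fun=> beth_pt n).
    have [f f_inj] := sort_beth j Mt f0; have [g g_inj] := beth_le jn.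
    by exists (g \o f) => x y _ jx jy /g_inj; exact: f_inj.
  by have [F F_inj] := choice E; exists F => j x y jn; exact: F_inj.
pose s x := cid2 (srt_ex Mt x).
exists (fun x => J (s2val (s x), F (s2val (s x)) x)) => x y /J_inj[E].
rewrite E; apply: F_inj; first exact: (s2valP (s y)).
  by rewrite -E; exact: (s2valP' (s x)).
exact: (s2valP' (s y)).
Qed.

Lemma cantor_inj (T : Type) (f : set T -> T) : ~ injective f.
Proof.
move=> f_inj; pose A : set T := [set x | exists B, x = f B /\ ~ B x].
have [AfA|nAfA] := pselect (A (f A)); last by apply: (nAfA); exists A; split.
by have [B [/f_inj <- /(_ AfA)]] := AfA.
Qed.

(** [tree_beth] would embed [beth_omega], and with it [beth n.+1], into [beth n], against Cantor's
    theorem. *)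
Lemma no_beth_omega_model n (M : structure tree_language) :
  ~ two_cardinal_model (tree_theory n) (RSort 0 : rsym tree_language)
      beth_omega nat M.
Proof.
case=> /model_tree_theory Mt; rewrite !card_eq_le => /andP[_ leM] /andP[le0 _].
have /(tree_beth Mt)[f f_inj] : exists f : tree_of M -> nat, forall x y,
    srt 0 x -> srt 0 y -> f x = f y -> x = y.
  have /countable_injP[f f_inj] := le0.
  by exists f => x y x0 y0; apply: f_inj; exact: mem_set.
have /card_le_injP[g g_inj] := leM.
have /card_le_injP[h h_inj] := beth_omega_sup.1 n.+1.
apply: (@cantor_inj (beth n) (f \o (g \o h))).
exact: inj_comp f_inj (inj_comp g_inj h_inj).
Qed.

(** * Counting the types over a closed tuple *)

Lemma poly_lt_exp C E : exists K, (C * K.+1) ^ E < 2 ^ K.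
Proof.
(* With [K.+1 = 2 ^ t] the left side is at most [2 ^ ((C + t) * E)]; taking [t] to be twice [u]
   makes [2 ^ t] at least [u.+1 ^ 2], which beats that exponent. *)
pose u := C + 2 * E + 2; pose t := 2 * u; exists (2 ^ t).-1.
have u2 : u < 2 ^ u by exact: ltn_expl.
have tE : u.+1 ^ 2 <= 2 ^ t by rewrite /t mulnC expnM leq_exp2r.
have t0 : 0 < 2 ^ t by rewrite expn_gt0.
rewrite prednK //; apply: (@leq_ltn_trans ((2 ^ C * 2 ^ t) ^ E)).
  by case: (posnP E) => [->//|E0]; rewrite leq_exp2r // leq_mul2r ltnW ?orbT // ltn_expl.
rewrite -expnD -expnM ltn_exp2l //.
rewrite /t in tE t0 *; move: (2 ^ (2 * u)) tE t0 => w; rewrite /u; nia.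
Qed.

Section CodeCounting.
Variables (n : nat) (M : tree_structure).
Hypothesis Mt : tree_axioms n M.

(** A code is used only through its first six values, so finitely many numbers describe it. *)
Lemma code_eq k (e : nat -> M) x (c c' : nat -> nat) :
  agree 6 c c' -> code k e x c -> code k e x c'.
Proof.
move=> E [[zk xz]|[far js neq above below d xcl]].
  by left; rewrite -E.
by right; split=> //; rewrite -!E.
Qed.

Lemma codes_piso k m (e e' : nat -> M) (c : nat -> nat -> nat) :
  agree k e e' -> closed k e ->
  (forall i, i < m -> code (k + i) e (e (k + i)) (c i)) ->
  (forall i, i < m -> code (k + i) e' (e' (k + i)) (c i)) ->
  piso (k + m) e e'.
Proof.
move=> ee' cl; elim: m => [|m IH] ce ce'.
  by rewrite addn0; exact: piso_refl.
rewrite addnS; apply: (code_ext Mt Mt) (ce _ (ltnSn m)) (ce' _ (ltnSn m)).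
by apply: IH => i im; [apply: ce|apply: ce']; exact: ltnW.
Qed.

Lemma add_points_codes k (e : nat -> M) t (x : nat -> M) : closed k e ->
  exists e' (r : nat -> nat) (c : nat -> nat -> nat),
  [/\ agree k e' e,
      forall s, s < t -> r s < k + t * n.+1 /\ e' (r s) = x s,
      forall i s, i < t * n.+1 -> c i s < n + k + t * n.+1 &
      forall i, i < t * n.+1 -> code (k + i) e' (e' (k + i)) (c i)].
Proof.
move=> cl; have [e' [r [e'e cl' rP]]] := add_points Mt t x cl.
have E i : exists c : nat -> nat,
    (forall s, c s <= maxn n (k + i)) /\ code (k + i) e' (e' (k + i)) c.
  have ki := leq_addr i k.
  exact: code_of_closed Mt (cl' _ ki) (cl' _ (leqW ki)).
have [c cP] := choice E; exists e', r, c; split=> //.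
- move=> i s im; have [/(_ s) h _] := cP i.
  by rewrite (leq_ltn_trans h) // gtn_max; apply/andP; split; lia.
- by move=> i im; have [] := cP i.
Qed.

End CodeCounting.

Lemma dependent_tree_theory n : dependent (tree_theory n).
Proof.
move=> p q phi [M [a [b [/model_tree_theory Mt ab]]]].
set m := q * n.+1.
(* The exponent counts the six code values of each of [m] added points and the positions of [q]
   coordinates; the base bounds [B.+1], the number of possible values of each. *)
have [K KE] := poly_lt_exp (p * n.+1 + m + n + 1) (6 * m + q).
set N := (K * p) * n.+1; set B := n + N + m.
have [x0] := carrier_inhabited M.
pose tup h (f : 'I_h -> M) (t : nat) : M := if insub t is Some i then f i else x0.
have tupE h (f : 'I_h -> M) (i : 'I_h) : tup h f i = f i by rewrite /tup valK.
have cl0 : closed 0 (fun=> x0 : tree_of M) by [].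
(* The first [K] tuples are flattened into one list, with coordinate [t] of [a i] at position
   [i * p + t]. *)
have [eA [rA [_ clA rAP]]] :=
  add_points Mt (K * p) (fun t => tup p (a (t %/ p)) (t %% p)) cl0.
have clN : closed N eA by exact: clA.
have aE (i : 'I_K) (t : 'I_p) :
    rA (i * p + t) < N /\ eA (rA (i * p + t)) = a i t.
  have p0 : 0 < p by exact: leq_ltn_trans (ltn_ord t).
  have itp : i * p + t < K * p.
    by have := ltn_ord i; have := ltn_ord t; nia.
  have [h ->] := rAP _ itp.
  by rewrite divnMDl // divn_small // addn0 modnMDl modn_small // tupE.
pose toset (s : {set 'I_K}) : set nat :=
  [set i : nat | exists2 j : 'I_K, j \in s & i = nat_of_ord j].
have E (s : {set 'I_K}) := add_points_codes Mt q (tup q (b (toset s))) clN.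
have [es esP] := choice E.
have [rs rsP] := choice esP.
have [cs csP] := choice rsP.
pose sig (s : {set 'I_K}) : {ffun 'I_m * 'I_6 -> 'I_B.+1} * {ffun 'I_q -> 'I_B.+1} :=
  ([ffun it : 'I_m * 'I_6 => inord (cs s it.1 it.2)], [ffun t : 'I_q => inord (rs s t)]).
(* By counting, two of the [2 ^ K] sets have parameters with the same signature over the closure of
   the tuples [a i]. *)
have [s [s' [ss' sigE]]] : exists s s', s != s' /\ sig s = sig s'.
  apply: contrapT => none; have sig_inj : injective sig.
    move=> s s' sigE; apply/eqP/negPn/negP => ss'.
    by apply: none; exists s, s'.
  have := leq_card sig sig_inj; rewrite card_prod !card_ffun card_prod !card_ord.
  rewrite -expnD -cardsT -powersetT card_powerset cardsT card_ord leqNgt.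
  move/negP; apply; apply: leq_ltn_trans KE.
  rewrite mulnC; have [->//|h0] := posnP (6 * m + q).
  by rewrite leq_exp2r // /B /N; nia.
have [ag1 r1 cb1 c1] := csP s; have [ag2 r2 cb2 c2] := csP s'.
have /ffunP ceq := congr1 fst sigE; have /ffunP req := congr1 snd sigE.
have NB i : i < N + m -> i < B.+1 by rewrite /B; lia.
have rE (t : 'I_q) : rs s t = rs s' t.
  have [h1 _] := r1 _ (ltn_ord t); have [h2 _] := r2 _ (ltn_ord t).
  by have := congr1 (@nat_of_ord _) (req t); rewrite !ffunE !inordK //; exact: NB.
have cE i : i < m -> agree 6 (cs s i) (cs s' i).
  move=> im t t6; have := congr1 (@nat_of_ord _) (ceq (Ordinal im, Ordinal t6)).
  by rewrite !ffunE /= !inordK //; [have := cb2 i t im|have := cb1 i t im]; rewrite /B /m; lia.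
(* Equal codes make the two closures isomorphic over the entries of [eA], so [phi] cannot tell [s]
   from [s'] on any [a i]. *)
have I : piso (N + m) (es s) (es s').
  apply: (codes_piso Mt (c := cs s)) => //.
  - exact: agree_trans ag1 (agree_sym ag2).
  - exact: agree_closed (agree_sym ag1) clN.
  - by move=> i im; apply: code_eq (agree_sym (cE i im)) (c2 i im).
have abE (i : 'I_K) : toset s i <-> toset s' i.
  pose r (t : 'I_(p + q)) : nat := match fintype.split t with
    inl j => rA (i * p + j) | inr j => rs s j end.
  have rN t : r t < N + m.
    rewrite /r; case: (fintype.split t) => j; first by have [h _] := aE i j; lia.
    by have [] := r1 _ (ltn_ord j).
  rewrite -!ab.
  have -> : ecat (a i) (b (toset s)) = (fun t => es s (r t)).
    apply/funext => t; rewrite /ecat /r; case: (fintype.split t) => j.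
      by have [h <-] := aE i j; rewrite ag1.
    by have [_ ->] := r1 _ (ltn_ord j); rewrite tupE.
  have -> : ecat (a i) (b (toset s')) = (fun t => es s' (r t)).
    apply/funext => t; rewrite /ecat /r; case: (fintype.split t) => j.
      by have [h <-] := aE i j; rewrite ag2.
    by rewrite rE; have [_ ->] := r2 _ (ltn_ord j); rewrite tupE.
  exact: (sat_piso phi Mt Mt I rN).
have tosetE (s0 : {set 'I_K}) (i : 'I_K) : toset s0 i <-> i \in s0.
  by split=> [[j js0 /val_inj ->]//|is0]; exists i.
case/eqP: ss'; apply/setP => i; apply/idP/idP => /tosetE; rewrite ?abE => /tosetE //.
by move/tosetE/abE/tosetE.
Qed.

(** * Words and branches *)

Definition linear T (R : T -> T -> Prop) : Prop :=
  [/\ forall x, ~ R x x, forall x y z, R x y -> R y z -> R x z &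
      forall x y, [\/ x = y, R x y | R y x]].

Definition wo_set T (R : T -> T -> Prop) (A : set T) : Prop :=
  forall B, B `<=` A -> B !=set0 -> exists2 z, B z & forall y, B y -> ~ R y z.

Lemma sub_wo_set T (R : T -> T -> Prop) A B :
  A `<=` B -> wo_set R B -> wo_set R A.
Proof. by move=> AB Bwo C CA; apply: Bwo => x /CA/AB. Qed.

Lemma wo_setU T (R : T -> T -> Prop) A B : linear R ->
  wo_set R A -> wo_set R B -> wo_set R (A `|` B).
Proof.
move=> [irr tr tot] Awo Bwo C CAB [x Cx].
have [CA|nCA] := pselect (C `&` A !=set0); last first.
  apply: Bwo; last by exists x.
  by move=> y Cy; case: (CAB y Cy) => // Ay; case: nCA; exists y.
have [CB|nCB] := pselect (C `&` B !=set0); last first.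
  apply: Awo; last by exists x.
  by move=> y Cy; case: (CAB y Cy) => // By; case: nCB; exists y.
have [a [Ca Aa] amin] := Awo _ (@subIsetr _ C A) CA.
have [b [Cb Bb] bmin] := Bwo _ (@subIsetr _ C B) CB.
have le y z w : ~ R y z -> R w z -> ~ R y w.
  by move=> nyz wz yw; apply: nyz; exact: tr yw wz.
have [ab|ab|ba] := tot a b.
- exists a => // y Cy; case: (CAB y Cy) => [Ay|By]; first exact: amin.
  by rewrite ab; exact: bmin.
- exists a => // y Cy; case: (CAB y Cy) => [Ay|By]; first exact: amin.
  exact: le (bmin y _) ab.
- exists b => // y Cy; case: (CAB y Cy) => [Ay|By]; last exact: bmin.
  exact: le (amin y _) ba.
Qed.

Lemma wo_set1 T (R : T -> T -> Prop) x : linear R -> wo_set R [set x].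
Proof.
by move=> [irr _ _] B Bx [y By]; exists y => // z /Bx ->; rewrite (Bx y By).
Qed.

Lemma wo_ex T : exists R : T -> T -> Prop, linear R /\ wo_set R setT.
Proof.
have [R wo] := @well_ordering_principle {classic T}.
have min (A : set T) : A !=set0 -> exists2 z, A z & forall y, A y -> R z y.
  move=> [x Ax]; have [|z [[zA zmin] _]] := wo (fun y => `[<A y>]).
    by exists x; rewrite unfold_in; exact/asboolP.
  move: zA; rewrite unfold_in => /asboolP Az; exists z => // y Ay.
  by apply: zmin; rewrite unfold_in; exact/asboolP.
(* Totality, antisymmetry and transitivity are read off the least elements of sets of at most three
   points. *)
have tot x y : R x y \/ R y x.
  have [|z zxy zmin] := min [set z | z = x \/ z = y]; first by exists x; left.
  by case: zxy zmin => -> zmin; [left|right]; apply: zmin; [right|left].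
have refl x : R x x by case: (tot x x).
have anti x y : R x y -> R y x -> x = y.
  move=> xy yx; have [|z [_ uz]] := wo (fun z => `[<z = x \/ z = y>]).
    by exists x; rewrite unfold_in; apply/asboolP; left.
  have xm : minimum_of R (fun z => `[<z = x \/ z = y>]) x.
    split; first by rewrite unfold_in; apply/asboolP; left.
    by move=> w; rewrite unfold_in => /asboolP[->|->].
  have ym : minimum_of R (fun z => `[<z = x \/ z = y>]) y.
    split; first by rewrite unfold_in; apply/asboolP; right.
    by move=> w; rewrite unfold_in => /asboolP[->|->].
  by rewrite -(uz x xm) -(uz y ym).
have tr x y z : R x y -> R y z -> R x z.
  move=> xy yz; have [|w wxyz wmin] := min [set w | [\/ w = x, w = y | w = z]].
    by exists x; constructor 1.
  have wx := wmin x (Or31 _ _ erefl); have wy := wmin y (Or32 _ _ erefl).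
  have wz := wmin z (Or33 _ _ erefl).
  case: wxyz => E; rewrite E in wx wy wz => //.
    by rewrite (anti x y).
  by rewrite -(anti y z).
exists (fun x y : T => R x y /\ x <> y); split.
  split=> [x [] //|x y z [xy nxy] [yz nyz]|x y].
    split; first exact: tr xy yz.
    by move=> E; rewrite -E in yz; exact/nxy/anti.
  have [->|nxy] := pselect (x = y); first by constructor 1.
  by case: (tot x y) => h; [constructor 2|constructor 3]; split=> //; exact: nesym.
move=> B _ /min[z Bz zmin]; exists z => // y By [yz nyz].
by apply: nyz; apply: anti => //; exact: zmin.
Qed.

Section Words.
Variables (Y : Type) (ry : Y -> Y -> Prop).
Hypotheses (ry_lin : linear ry) (ry_wo : wo_set ry setT).

(** The integer part compares first, which leaves no least or greatest letter and lets one letter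
    exceed another whatever its component in [Y]. *)
Definition letter : Type := int * Y.

Definition lt_letter (a b : letter) : Prop :=
  (a.1 < b.1)%R \/ a.1 = b.1 /\ ry a.2 b.2.

Lemma lt_letter_linear : linear lt_letter.
Proof.
case: ry_lin => irr tr tot; split=> [[i y]|[i y] [j z] [k w]|[i y] [j z]];
  rewrite /lt_letter /=.
- by case=> [|[_]]; [lia|exact: irr].
- case=> [ij|[ij yz]] [jk|[jk zw]]; try by left; lia.
  by right; split; [lia|exact: tr zw].
- have [ij|ij|->] : [\/ (i < j)%R, (j < i)%R | i = j].
  + have [|[]] : (i < j)%R \/ (j < i)%R \/ i = j by lia.
    * by constructor 1.
    * by constructor 2.
    * by constructor 3.
  + by constructor 2; left.
  + by constructor 3; left.
  + have [->|yz|zy] := tot y z; first by constructor 1.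
    * by constructor 2; right.
    * by constructor 3; right.
Qed.

Fixpoint lt_seq (s t : seq letter) : Prop :=
  match s, t with
  | [::], [::] => False
  | [::], _ => True
  | _, [::] => False
  | a :: s', b :: t' => lt_letter a b \/ a = b /\ lt_seq s' t'
  end.

(* Words are nonempty, so that there is no least word. *)
Definition word : Type := letter * seq letter.

Definition lt_word (w w' : word) : Prop := lt_seq (w.1 :: w.2) (w'.1 :: w'.2).

Lemma lt_seq_linear : linear lt_seq.
Proof.
have [irr tr tot] := lt_letter_linear; split.
- by elim=> [|a s IH] //= [/irr|[_ /IH]].
- elim=> [|a s IH] [|b t] [|c u] //= [ab|[ab st]] [bc|[bc tu]].
  + by left; exact: tr bc.
  + by left; rewrite -bc.
  + by left; rewrite ab.
  + rewrite ab bc; by right; split=> //; exact: IH tu.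
- elim=> [|a s IH] [|b t] /=.
  + by constructor 1.
  + by constructor 2.
  + by constructor 3.
  + have [->|ab|ba] := tot a b.
    * have [->|st|ts] := IH t; first by constructor 1.
        by constructor 2; right.
      by constructor 3; right.
    * by constructor 2; left.
    * by constructor 3; left.
Qed.

Lemma lt_word_linear : linear lt_word.
Proof.
have [irr tr tot] := lt_seq_linear; split.
- by move=> w; exact: irr.
- by move=> u v w; exact: tr.
- move=> [a s] [b t]; have [[-> ->]|ab|ba] := tot (a :: s) (b :: t).
  + by constructor 1.
  + by constructor 2.
  + by constructor 3.
Qed.

Definition label (w : word) : Y := (last w.1 w.2).2.

(** If [t] extends [s], the new letter gets an integer part below that of the next letter of [t];
    otherwise [t] exceeds [s] at an earlier letter and any letter may be appended. In both cases [y]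
    is free, so every label occurs in every interval. *)
Lemma lt_seq_rcons s t y : lt_seq s t ->
  exists k, lt_seq s (rcons s (k, y)) /\ lt_seq (rcons s (k, y)) t.
Proof.
elim: s t => [|a s IH] [|b t] //=.
  by exists (b.1 - 1)%R; split=> //; left; left=> /=; lia.
case=> [ab|[-> /IH[k [sk kt]]]]; last by exists k; split; right.
have slt u x : lt_seq u (rcons u x) by elim: u => //= c u IHu; right.
by exists 0%R; split; [right|left].
Qed.

Lemma word_between u v y : lt_word u v ->
  exists w, [/\ lt_word u w, lt_word w v & label w = y].
Proof.
case: u => a s /(lt_seq_rcons y)[k [uk kv]].
by exists (a, rcons s (k, y)); split=> //; rewrite /label last_rcons.
Qed.

Lemma word_above u y : exists2 w, lt_word u w & label w = y.
Proof. by exists ((u.1.1 + 1, y), [::])%R => //; left; left=> /=; lia. Qed.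

Lemma word_below u y : exists2 w, lt_word w u & label w = y.
Proof. by exists ((u.1.1 - 1, y), [::])%R => //; left; left=> /=; lia. Qed.

(** These words form countably many copies of [Y], one above the other; for a well-ordered [Y] they
    are together well-ordered, and they are cofinal among all words. *)
Definition std (k : nat) (y : Y) : word := ((k%:Z, y), [::])%R.

Lemma std_cofinal u : exists k, forall y, lt_word u (std k y).
Proof. by exists `|u.1.1|.+1 => y; left; left => /=; lia. Qed.

Lemma std_wo : wo_set lt_word [set w | exists k y, w = std k y].
Proof.
move=> B Bstd [w Bw]; have [k0 [y0 w0]] := Bstd w Bw.
have kex : exists k, `[<exists y, B (std k y)>].
  by exists k0; apply/asboolP; exists y0; rewrite -w0.
case: (ex_minnP kex) => k /asboolP[y1 Bky1] kmin.
have [|y By ymin] := ry_wo (B := [set y | B (std k y)]) (@subsetT _ _).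
  by exists y1.
exists (std k y) => // u Bu; have [k' [y' E]] := Bstd u Bu; rewrite {}E in Bu *.
have kk' : k <= k' by apply: kmin; apply/asboolP; exists y'.
case=> [[/=|[/= E yy']]|[_ []]]; first by lia.
have {}E : k' = k by lia.
by rewrite E in Bu; exact: (ymin y' Bu).
Qed.

End Words.

(** * Branches coded by words *)

Section Level.
Variables (Y Y' : Type) (ry : Y -> Y -> Prop).
Hypotheses (ry_lin : linear ry) (ry_wo : wo_set ry setT).
Variables (decode : Y' -> set (word Y) * word Y) (iota : word Y' -> set Y).
Hypotheses (decode_surj : forall p, exists y, decode y = p).
Hypothesis iota_inj : injective iota.

(* A word [w] stands for the branch that follows the node [decode (label w)]
   and then the copies of [iota w] that are cofinal among the levels. *)
Definition supp (w : word Y') : set (word Y) :=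
  let: (p, l) := decode (label w) in
  [set x | [/\ wo_set (lt_word ry) p, ~ lt_word ry l x & p x] \/
    lt_word ry l x /\ exists k y, iota w y /\ x = std k y].

(** The condition on [p] inside [supp] leaves at most a union of two well-ordered sets. Well-ordered
    supports give two different branches a least level of disagreement. *)
Lemma supp_wo w : wo_set (lt_word ry) (supp w).
Proof.
have lin := lt_word_linear ry_lin.
rewrite /supp; case: (decode (label w)) => p l.
have [pwo|npwo] := pselect (wo_set (lt_word ry) p).
  apply: sub_wo_set (wo_setU lin pwo (std_wo ry_wo)) => x [[_ _ px]|[_]].
    by left.
  by case=> k [y [_ ->]]; right; exists k, y.
apply: sub_wo_set (std_wo ry_wo) => x [[//]|[_ [k [y [_ ->]]]]].
by exists k, y.
Qed.

Definition wdist (w w' : word Y') (l : word Y) : Prop :=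
  ~ (supp w l <-> supp w' l) /\
  forall x, lt_word ry x l -> supp w x <-> supp w' x.

(** The sets [iota w] and [iota w'] differ at some [y], and far enough up, beyond both decoded
    nodes, the supports copy this difference. *)
Lemma supp_sep w w' : w <> w' -> exists x, ~ (supp w x <-> supp w' x).
Proof.
move=> ww'; have [irr tr tot] := lt_word_linear ry_lin.
have [y ny] : exists y, ~ (iota w y <-> iota w' y).
  apply: contrapT => none; apply: ww'; apply: iota_inj; apply/funext => y.
  by apply/propext; apply: contrapT => ny; apply: none; exists y.
have suppE u k : lt_word ry (decode (label u)).2 (std k y) ->
    supp u (std k y) <-> iota u y.
  rewrite /supp; case: (decode (label u)) => p l /= lk; split.
    by case=> [[_ /(_ lk)]//|[_ [k' [y' [uy' [_ ->]]]]]].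
  by move=> uy; right; split=> //; exists k, y.
have [k1 k1P] := std_cofinal ry (decode (label w)).2.
have [k2 k2P] := std_cofinal ry (decode (label w')).2.
have std_le k k' : k <= k' -> forall u, lt_word ry u (std k y) ->
    lt_word ry u (std k' y).
  rewrite leq_eqVlt => /orP[/eqP -> //|kk'] u uk; apply: tr uk _.
  by left; left => /=; lia.
exists (std (maxn k1 k2) y).
rewrite !suppE //; apply: std_le; [exact: leq_maxr|exact: k2P|
  exact: leq_maxl|exact: k1P].
Qed.

Lemma wdist_total w w' : w <> w' -> exists l, wdist w w' l.
Proof.
move=> /supp_sep[x nx].
have wo := wo_setU (lt_word_linear ry_lin) (@supp_wo w) (@supp_wo w').
have [|l nl lmin] := wo [set x | ~ (supp w x <-> supp w' x)] _ (ex_intro _ x nx).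
  by move=> z /= nz; apply: contrapT => nw; apply: nz; split=> h; case: nw; [left|right].
by exists l; split=> // z zl; apply: contrapT => /lmin.
Qed.

Lemma wdist_irr w l : ~ wdist w w l.
Proof. by case=> n _; exact: n. Qed.

Lemma wdist_sym w w' l : wdist w w' l -> wdist w' w l.
Proof. by case=> nl lP; split=> [|x /lP]; tauto. Qed.

Lemma wdist_fun w w' l m : wdist w w' l -> wdist w w' m -> l = m.
Proof.
move=> [nl lP] [nm mP]; have [_ _ /(_ l m)] := lt_word_linear ry_lin.
by case=> // [/mP|/lP].
Qed.

Lemma wdist_ultra x y z l m :
  wdist x y l -> wdist y z m -> lt_word ry l m -> wdist x z l.
Proof.
have [_ tr _] := lt_word_linear ry_lin.
move=> [nl lP] [nm mP] lm; split; first by rewrite -(mP l lm).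
by move=> u ul; rewrite (lP u ul) (mP u (tr _ _ _ ul lm)).
Qed.

(** Membership has only two values: branches that both disagree with [y] at [l] agree with each
    other there, and they agree below [l] as well. *)
Lemma wdist_binary x y z l : wdist x y l -> wdist y z l ->
  x = z \/ exists2 m, wdist x z m & lt_word ry l m.
Proof.
have [_ tr tot] := lt_word_linear ry_lin.
move=> [nl lP] [nm mP]; have [->|/wdist_total[m xzm]] := pselect (x = z).
  by left.
right; exists m => //; case: xzm => nxz _.
have xzl : supp x l <-> supp z l 
  by case: (pselect (supp x l)) (pselect (supp y l)) (pselect (supp z l)) => ? [] ? [] ?; tauto.
have [E|//|ml] := tot l m; first by rewrite -E in nxz.
by case: nxz; rewrite (lP m ml) (mP m ml).
Qed.

(** The chosen node agrees with [a] except that membership is flipped at [l], so every word that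
    follows it leaves [a] exactly at [l]. Since labels occur everywhere in the order, this yields
    the density of spheres. *)
Lemma sphere_label a l : exists y, forall w, label w = y -> wdist w a l.
Proof.
have [irr tr tot] := lt_word_linear ry_lin.
pose p := [set x | x = l /\ ~ supp a l \/ x <> l /\ supp a x].
have pwo : wo_set (lt_word ry) p.
  have lwo := @wo_set1 _ _ l (lt_word_linear ry_lin).
  apply: sub_wo_set (wo_setU (lt_word_linear ry_lin) (@supp_wo a) lwo).
  by move=> x [[-> _]|[_ ax]]; [right|left].
have [y yP] := decode_surj (p, l); exists y => w wy.
have wE x : ~ lt_word ry l x -> supp w x <-> p x.
  by rewrite /supp wy yP => lx; split=> [[[]//|[/lx]]//|px]; left.
split=> [|x xl].
  rewrite wE // /p /=; tauto.
rewrite wE; last by move=> lx; exact: irr (tr _ _ _ xl lx).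
have xNl : x <> l by move=> E; rewrite E in xl; exact: irr xl.
by rewrite /p /=; tauto.
Qed.

End Level.

(** * Large models *)

(** For positive [m], tag [i.+1] stores the set at position [i]. The length is stored separately,
    under tag 0, because trailing empty sets would otherwise be lost. *)
Lemma beth_seq m : exists f : seq (beth m) -> beth m, injective f.
Proof.
case: m => [|m]; first by exists pickle; exact: (pcan_inj pickleK).
have [J J_inj] := beth_pair m; pose d := beth_pt m.
exists (fun s => [set J (0, J (size s, d))] `|`
  [set J (p.1.+1, p.2) | p in [set p : nat * beth m | nth set0 s p.1 p.2]]).
move=> s t E; have sz : size s = size t.
  have : ([set J (0, J (size s, d))] `|`
    [set J (p.1.+1, p.2) | p in [set p : nat * beth m | nth set0 s p.1 p.2]])
      (J (0, J (size s, d))) by left.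
  by rewrite E => -[/J_inj[/J_inj[]]|[p _ /J_inj[]]].
have sub (s1 t1 : seq (set (beth m))) : [set J (0, J (size s1, d))] `|`
    [set J (p.1.+1, p.2) | p in [set p : nat * beth m | nth set0 s1 p.1 p.2]] =
    [set J (0, J (size t1, d))] `|`
    [set J (p.1.+1, p.2) | p in [set p : nat * beth m | nth set0 t1 p.1 p.2]] ->
    forall i, nth set0 s1 i `<=` nth set0 t1 i.
  move=> E1 i y sy.
  have : ([set J (0, J (size s1, d))] `|`
    [set J (p.1.+1, p.2) | p in [set p : nat * beth m | nth set0 s1 p.1 p.2]])
      (J (i.+1, y)) by right; exists (i, y).
  by rewrite E1 => -[/J_inj[]//|[[i' y'] /= ty /J_inj[<- <-]]].
by apply: (@eq_from_nth _ set0) => // i _; apply/seteqP; split; exact: sub.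
Qed.

Lemma beth_word m : exists f : word (beth m) -> beth m, injective f.
Proof.
have [J J_inj] := beth_pair m; have [S S_inj] := beth_seq m.
pose h (a : letter (beth m)) := J (pickle a.1, a.2).
have h_inj : injective h.
  by move=> [i y] [j z] /J_inj[/(pcan_inj pickleK) /= -> ->].
exists (fun w => S (map h (w.1 :: w.2))) => -[a s] [b t] /S_inj /= [/h_inj -> st].
by rewrite (inj_map h_inj st).
Qed.

Lemma inj_surj (S T : Type) (f : S -> T) : inhabited S -> injective f ->
  exists g : T -> S, forall x, exists y, g y = x.
Proof.
move=> [s] f_inj.
have E y : exists x, (exists x', f x' = y) -> f x = y.
  have [[x xy]|n] := pselect (exists x', f x' = y); first by exists x.
  by exists s => /n.
have [g gP] := choice E; exists g => x; exists (f x).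
by apply: f_inj; apply: gP; exists x.
Qed.

Local Notation W j := (word (beth j)).

Lemma level_decode j : exists decode : beth j.+1 -> set (W j) * W j,
  forall p, exists y, decode y = p.
Proof.
have [f f_inj] := beth_word j; have [S S_inj] := beth_seq j.+1.
(* A node is sent to a sequence of two subsets of [beth j], the second a singleton. *)
apply: (@inj_surj _ _ (fun p => S [:: f @` p.1; [set f p.2]] : beth j.+1)).
  by constructor; exact: (set0, std 0 (beth_pt j)).
move=> [A x] [B y] /S_inj /= [EA Exy].
have sub A1 B1 : f @` A1 = f @` B1 -> A1 `<=` B1.
  move=> E z Az; have : (f @` A1) (f z) by exists z.
  by rewrite E => -[z' Bz' /f_inj <-].
congr pair; first by apply/seteqP; split; apply: sub.
by apply: f_inj; have : [set f y] (f x) by rewrite -Exy.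
Qed.

(** * The sorts of words assembled into one structure *)

Definition wo_rel j : beth j -> beth j -> Prop := sval (cid (wo_ex (beth j))).
Definition wo_relP j : linear (@wo_rel j) /\ wo_set (@wo_rel j) setT :=
  svalP (cid (wo_ex (beth j))).
Definition decode j := sval (cid (level_decode j)).
Definition decodeP j : forall p, exists y, @decode j y = p :=
  svalP (cid (level_decode j)).
(** [beth j.+1] is by definition the power set of [beth j], so an injection of words into it is
    already a family of distinct sets. *)
Definition iota_ j : W j.+1 -> set (beth j) := sval (cid (beth_word j.+1)).
Definition iotaP j : injective (@iota_ j) := svalP (cid (beth_word j.+1)).

Definition ltW j : W j -> W j -> Prop := lt_word (@wo_rel j).
Definition distW j : W j.+1 -> W j.+1 -> W j -> Prop :=
  wdist (@wo_rel j) (@decode j) (@iota_ j).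

Lemma ltW_linear j : linear (@ltW j).
Proof. exact: lt_word_linear (wo_relP j).1. Qed.

Definition points : Type := {j : nat & W j}.
Definition pnt j (w : W j) : points := existT (fun j => W j) j w.

Inductive ltU : points -> points -> Prop :=
| LtU j (u v : W j) : ltW u v -> ltU (pnt u) (pnt v).
Inductive distU : points -> points -> points -> Prop :=
| DistU j (u v : W j.+1) (l : W j) : distW u v l -> distU (pnt u) (pnt v) (pnt l).

Lemma pnt_inj j : injective (@pnt j).
Proof. by move=> u v; exact: (@existT_inj2 nat (fun j => W j)). Qed.

Lemma ltU_inv j (u : W j) y : ltU (pnt u) y -> exists2 v : W j, y = pnt v & ltW u v.
Proof.
move Ex: (pnt u) => x xy; case: xy Ex => i u1 v1 uv Ex.
have Eij : j = i := congr1 (@projT1 _ _) Ex.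
by case: _ / Eij u1 v1 uv Ex => u1 v1 uv /pnt_inj ->; exists v1.
Qed.

(** The equation between sorts is kept as a cast, which [distU_succ] later removes by uniqueness of
    equality proofs on [nat]. *)
Lemma distU_inv j (u : W j) y l : distU (pnt u) y l ->
  exists i (E : j = i.+1) (v : W i.+1) (m : W i),
    [/\ y = pnt v, l = pnt m & distW (ecast k (W k) E u) v m].
Proof.
move Ex: (pnt u) => x xyl; case: xyl Ex => i u1 v1 m uvm Ex.
have Eij : i.+1 = j := esym (congr1 (@projT1 _ _) Ex).
case: _ / Eij u Ex => u /pnt_inj ->.
by exists i, erefl, v1, m.
Qed.

Lemma ltU_pnt j (u v : W j) : ltU (pnt u) (pnt v) <-> ltW u v.
Proof. by split=> [/ltU_inv[v' /pnt_inj ->]|]; [|exact: LtU]. Qed.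

Lemma ltU_tag x y : ltU x y -> tag x = tag y.
Proof. by case. Qed.

Definition subtree (M : tree_structure) (C : set M) : tree_structure :=
  @TreeStructure {x | C x} (fun j x => srt j (sval x))
    (fun x y => lt (sval x) (sval y))
    (fun x y l => dist (sval x) (sval y) (sval l)).

Lemma sval_set_inj T (C : set T) (x y : {x | C x}) : sval x = sval y -> x = y.
Proof.
by case: x y => [x Cx] [y Cy] /= E; subst y; rewrite (Prop_irrelevance Cx Cy).
Qed.

Definition universe : tree_structure :=
  @TreeStructure points (fun j x => tag x = j) ltU distU.

Definition levels n : tree_structure :=
  @subtree universe [set x : points | tag x <= n].

Lemma points_sphere j (a : W j) (l : universe) : @radius universe j l ->
  exists y, forall w : W j, label w = y -> @sphere universe j (pnt w) (pnt a) l.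
Proof.
case: j a => [|j] a /=; first by exists (beth_pt 0).
case: l => i m /= E; case: _ / E a => a.
have [lin wo] := wo_relP i.
have [y yP] := sphere_label lin wo (@iota_ i) (@decodeP i) a m.
by exists y => w /yP ?; exact: DistU.
Qed.

Lemma ltU_irr x : ~ ltU x x.
Proof. by case: x => j u /ltU_pnt; have [irr _ _] := ltW_linear j; exact: irr. Qed.

Lemma ltU_trans x y z : ltU x y -> ltU y z -> ltU x z.
Proof.
case=> j u v uv /ltU_inv[w -> vw].
by apply: LtU; have [_ tr _] := ltW_linear j; exact: tr vw.
Qed.

Lemma ltU_total x y : tag x = tag y -> [\/ x = y, ltU x y | ltU y x].
Proof.
case: x y => [j u] [i v] /= E; subst i.
have [_ _ /(_ u v)[E|uv|vu]] := ltW_linear j.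
- by constructor 1; rewrite E.
- by constructor 2; exact: LtU.
- by constructor 3; exact: LtU.
Qed.

Lemma distU_tag x y l : distU x y l -> tag x = (tag l).+1 /\ tag y = (tag l).+1.
Proof. by case. Qed.

Lemma distU_irr x l : ~ distU x x l.
Proof.
move Ey: {2}x => y d; case: d Ey => i u v m d /pnt_inj E.
by rewrite E in d; exact: wdist_irr d.
Qed.

Lemma distU_sym x y l : distU x y l -> distU y x l.
Proof. by case=> i u v m d; apply: DistU; exact: wdist_sym. Qed.

Lemma distU_succ i (u : W i.+1) y l : distU (pnt u) y l ->
  exists v (m : W i), [/\ y = pnt v, l = pnt m & distW u v m].
Proof.
move=> /distU_inv[i' [E [v [m [-> ->]]]]]; have [Ei] := E.
by case: _ / Ei E v m => E v m; rewrite eq_axiomK => d; exists v, m.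
Qed.

Lemma distU_fun x y l m : distU x y l -> distU x y m -> l = m.
Proof.
case=> i u v h d /distU_succ[v' [h' [/pnt_inj <- -> d']]].
by rewrite (wdist_fun (wo_relP i).1 d d').
Qed.

Lemma distU_total j x y : tag x = j.+1 -> tag y = j.+1 ->
  x = y \/ exists2 l, distU x y l & tag l = j.
Proof.
case: x y => [i u] [h v] /= Ei Eh; subst i h.
have [->|uv] := pselect (u = v); first by left.
have [l d] := wdist_total (wo_relP j).1 (wo_relP j).2 (@decode j) (@iotaP j) uv.
by right; exists (pnt l) => //; exact: DistU.
Qed.

Lemma distU_ultra x y z l m :
  distU x y l -> distU y z m -> ltU l m -> distU x z l.
Proof.
case=> i u v h d /distU_succ[v' [h' [-> -> d']]] /ltU_pnt lm.
by apply: DistU; exact: (wdist_ultra (wo_relP i).1 d d' lm).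
Qed.

Lemma distU_binary x y z l : distU x y l -> distU y z l ->
  x = z \/ exists2 m, distU x z m & ltU l m.
Proof.
case=> i u v h d /distU_succ[v' [h' [-> /pnt_inj <- d']]].
have := wdist_binary (wo_relP i).1 (wo_relP i).2 (@iotaP i) d d'.
case=> [->|[g dg lg]]; first by left.
by right; exists (pnt g); [exact: DistU|exact: LtU].
Qed.

Lemma levels_axioms n : tree_axioms n (levels n).
Proof.
split.
- by move=> [x xn]; exists (tag x).
- by move=> i j x /= <-.
- by move=> j x y /ltU_tag xy; split=> /= <-.
- by move=> x; exact: ltU_irr.
- by move=> x y z; exact: ltU_trans.
- move=> j x y <- xy; have := ltU_total (esym xy).
  case=> [/sval_set_inj E|xy'|yx'].
  + by constructor 1.
  + by constructor 2.
  + by constructor 3.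
- by move=> j x y l /distU_tag[Ex Ey] /= <-.
- by move=> x l; exact: distU_irr.
- by move=> x y l; exact: distU_sym.
- by move=> x y l m xyl xym; apply: sval_set_inj; exact: distU_fun xyl xym.
- move=> j x y jx jy; have [/sval_set_inj|[l d lj]] := distU_total jx jy; first by left.
  have ln : tag l <= n.
    by rewrite lj; apply: leq_trans (svalP x); rewrite jx.
  by right; exists (exist _ l ln).
- by move=> x y z l m; exact: distU_ultra.
- move=> x y z l xyl yzl; have [/sval_set_inj|[m d lm]] := distU_binary xyl yzl.
    by left.
  have mn : tag m <= n by rewrite -(ltU_tag lm); exact: svalP l.
  by right; exists (exist _ m mn).
- by move=> j jn; exists (exist _ (pnt (std 0 (beth_pt j))) jn).
- move=> j [[i u] p] [v q] [[k a] r] [l s] jn Ei uv Ek; simpl in Ei, Ek; subst i k.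
  (* The label [y] places every word carrying it on the sphere; it remains to find a word with that
     label in the interval. *)
  move=> jl; have [y yP] := points_sphere a (jl : @radius universe j l).
  have [v' /= Ev uv'] := ltU_inv uv.
  have [w [uw wv wy]] := word_between y uv'.
  exists (exist _ (pnt w) jn); split; [exact: LtU|by rewrite /= Ev; exact: LtU|].
  exact: yP w wy.
- move=> j [[i u] p] [[k a] r] [l s] jn Ei Ek; simpl in Ei, Ek; subst i k.
  move=> jl; have [y yP] := points_sphere a (jl : @radius universe j l).
  have [w uw wy] := word_above (@wo_rel j) u y.
  exists (exist _ (pnt w) jn); first exact: LtU.
  exact: yP w wy.
- move=> j [[i u] p] [[k a] r] [l s] jn Ei Ek; simpl in Ei, Ek; subst i k.
  move=> jl; have [y yP] := points_sphere a (jl : @radius universe j l).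
  have [w uw wy] := word_below (@wo_rel j) u y.
  exists (exist _ (pnt w) jn); first exact: LtU.
  exact: yP w wy.
Qed.

(** * Skolem hulls and the models of prescribed size *)

Lemma skolem_closure (M G : Type) (g : G -> M) (Q : nat -> seq M -> M -> Prop) :
  inhabited M ->
  exists C : set M, [/\ forall x, C (g x),
    forall k (s : seq {x | C x}), (exists y, Q k (map sval s) y) ->
      exists y : {x | C x}, Q k (map sval s) (sval y) &
    exists f : {x | C x} -> seq (nat + G), injective f].
Proof.
move=> [m]; have E (ks : nat * seq M) : exists y, (exists z, Q ks.1 ks.2 z) -> Q ks.1 ks.2 y.
  have [[z Qz]|n] := pselect (exists z, Q ks.1 ks.2 z); first by exists z.
  by exists m => /n.
have [op opP] := choice E.
(* Elements of the hull are values of finite terms: a leaf is a generator, and node [k] applies the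
   Skolem function for [Q k] to a list. Encoding terms as sequences bounds the size. *)
pose ev := fix ev (t : GenTree.tree G) : M := match t with
  | GenTree.Leaf x => g x
  | GenTree.Node k ts => op (k, map ev ts) end.
pose C : set M := [set x | exists t, ev t = x].
have [pre preP] := choice (fun x : {x | C x} => svalP x).
exists C; split.
- by move=> x; exists (GenTree.Leaf x).
- move=> k s Qs; have Cy : C (op (k, map sval s)).
    exists (GenTree.Node k (map pre s)) => /=; congr (op (k, _)).
    by elim: (s) => //= x s' ->; rewrite preP.
  by exists (exist _ _ Cy); exact: opP (k, map sval s) Qs.
- exists (GenTree.encode (T := G) \o pre).
  move=> x y /(pcan_inj (@GenTree.codeK G)) E'.
  by apply: sval_set_inj; rewrite -!preP E'.
Qed.

Lemma tree_skolem n (M : tree_structure) (G : Type) (g : G -> M) :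
  tree_axioms n M ->
  exists C : set M, [/\ forall x, C (g x), tree_axioms n (subtree C) &
    exists f : {x | C x} -> seq (nat + G), injective f].
Proof.
(* The length of the list tells which axiom asks for the witness. *)
move=> Mt; pose Q j (s : seq M) y := match s with
  | [::] => srt j y
  | [:: x; x'] => dist x x' y
  | [:: u; a; l] => lt u y /\ sphere j y a l
  | [:: u; v; a; l] => [/\ lt u y, lt y v & sphere j y a l]
  | [:: v; a; l; _; _] => lt y v /\ sphere j y a l
  | _ => False end.
have [x0 _] := srt_inh Mt (leq0n n).
have [C [Cg CQ Cf]] := skolem_closure g Q (inhabits x0).
exists C; split=> //; split.
- by move=> x; exact: (srt_ex Mt).
- by move=> i j x; exact: (srt_uniq Mt).
- by move=> j x y; exact: (lt_srt Mt).
- by move=> x; exact: (lt_irr Mt).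
- by move=> x y z; exact: (lt_trans Mt).
- move=> j x y jx jy; have [/sval_set_inj|xy|yx] := lt_total Mt jx jy.
  + by constructor 1.
  + by constructor 2.
  + by constructor 3.
- by move=> j x y l; exact: (dist_srt Mt).
- by move=> x l; exact: (dist_irr Mt).
- by move=> x y l; exact: (dist_sym Mt).
- by move=> x y l m d d'; apply: sval_set_inj; exact: (dist_fun Mt d d').
- move=> j x y jx jy; have [/sval_set_inj|d] := dist_total Mt jx jy; first by left.
  by right; exact: (CQ 0 [:: x; y] d).
- by move=> x y z l m; exact: (dist_ultra Mt).
- move=> x y z l d d'; have [/sval_set_inj|[m xzm lm]] := dist_binary Mt d d'.
    by left.
  have [m' xzm'] := CQ 0 [:: x; z] (ex_intro _ m xzm).
  by right; exists m' => //=; rewrite -(dist_fun Mt xzm xzm').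
- by move=> j jn; exact: (CQ j [::] (srt_inh Mt jn)).
- move=> j u v a l jn ju uv ja jl.
  exact: (CQ j [:: u; v; a; l] (sphere_dense Mt jn ju uv ja jl)).
- move=> j u a l jn ju ja jl.
  have [y uy ya] := sphere_above Mt jn ju ja jl.
  by have [y' []] := CQ j [:: u; a; l] (ex_intro _ y (conj uy ya)); exists y'.
- move=> j v a l jn jv ja jl.
  have [y yv ya] := sphere_below Mt jn jv ja jl.
  (* The repeated [l] pads the list to length five, which marks this axiom. *)
  by have [y' []] := CQ j [:: v; a; l; l; l] (ex_intro _ y (conj yv ya)); exists y'.
Qed.

Definition structure_of (M : tree_structure) (M_inh : inhabited M) :
    structure tree_language :=
  @Structure tree_language M M_inh (fun f => match f with end)
    (fun r => match r return ('I_(rarity (r : rsym tree_language)) -> M) -> Prop with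
      | RLt => fun a : 'I_2 -> M => lt (a ord0) (a o1of2)
      | RDist => fun a : 'I_3 -> M => dist (a ord0) (a o1of3) (a o2of3)
      | RSort j => fun a : 'I_1 -> M => srt j (a ord0)
      end).

Lemma structure_of_axioms n (M : tree_structure) (M_inh : inhabited M) :
  tree_axioms n M -> tree_axioms n (tree_of (structure_of M_inh)).
Proof. by case: M M_inh. Qed.

Lemma points_beth m : exists f : points -> beth m, forall x y,
  tag x <= m -> tag y <= m -> f x = f y -> x = y.
Proof.
have [J J_inj] := beth_pair m.
have E j : exists h : W j -> beth m, j <= m -> injective h.
  have [jm|_] := leqP j m; last by exists (fun=> beth_pt m).
  have [f f_inj] := beth_word j; have [h h_inj] := beth_le jm.
  by exists (h \o f) => _; exact: inj_comp.
pose h j := cid (E j).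
exists (fun x => J (tag x, sval (h (tag x)) (tagged x))).
move=> [j u] [i v] /= jm im /J_inj[Eij]; subst i.
by move=> /(svalP (h j) jm) ->.
Qed.

Lemma beth_seq_sum m (G : Type) (g : G -> beth m) : injective g ->
  exists f : seq (nat + G) -> beth m, injective f.
Proof.
move=> g_inj; have [J J_inj] := beth_pair m; have [S S_inj] := beth_seq m.
pose h (x : nat + G) := match x with
  inl k => J (k.+1, beth_pt m) | inr y => J (0, g y) end.
have h_inj : injective h.
  by move=> [k|y] [k'|y'] /J_inj //= => [[->]|[/g_inj ->]].
by exists (S \o map h); exact: inj_comp S_inj (inj_map h_inj).
Qed.

(** The hull is generated by all points of sort at most [m]; there are [beth m] many of these, and
    finite terms over them are no more. Sort 0 stays countable because it is countable already in
    [levels n]. *)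
Lemma tree_two_cardinal n m : m <= n -> exists M : structure tree_language,
  two_cardinal_model (tree_theory n) (RSort 0 : rsym tree_language) (beth m) nat M.
Proof.
move=> mn; pose G := {x : levels n | tag (sval x) <= m}.
have [f f_inj] := points_beth m.
have [h h_inj] : exists h : seq (nat + G) -> beth m, injective h.
  apply: (@beth_seq_sum m G (fun x => f (sval (sval x)))) => x y /f_inj E.
  by apply: sval_set_inj; apply: sval_set_inj; apply: E; [exact: svalP x|exact: svalP y].
have [C [CG Cax [F F_inj]]] := @tree_skolem n (levels n) G sval (levels_axioms n).
have lvl j (b : beth j) : j <= m -> exists x : {x | C x}, sval (sval x) = pnt (std 0 b).
  move=> jm; pose x : levels n := exist _ (pnt (std 0 b)) (leq_trans jm mn).
  by exists (exist _ x (CG (exist _ x jm))).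
have lvl_inj j (jm : j <= m) : exists s : beth j -> {x | C x},
    injective s /\ forall b, tag (sval (sval (s b))) = j.
  have [s sP] := choice (fun b => lvl j b jm); exists s.
  split=> [b b' E|b]; last by rewrite sP.
  by have /pnt_inj [] : pnt (std 0 b) = pnt (std 0 b') by rewrite -!sP E.
have [s [s_inj _]] := lvl_inj m (leqnn m).
have [s0 [s0_inj s0P]] := lvl_inj 0 (leq0n m).
exists (@structure_of (subtree C) (inhabits (s (beth_pt m)))); split.
- by apply/model_tree_theory; exact: structure_of_axioms.
- rewrite card_eq_le; apply/andP; split; apply/card_le_injP.
  + by exists (h \o F); exact: inj_comp.
  + by exists s.
- rewrite card_eq_le; apply/andP; split.
  + have [f0 f0_inj] := points_beth 0.
    apply/countable_injP; exists (fun x : {x | C x} => f0 (sval (sval x))).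
    move=> x y /set_mem x0 /set_mem y0 /f0_inj E.
    apply: sval_set_inj; apply: sval_set_inj; apply: E.
      by rewrite [tag _](x0 : tag (sval (sval x)) = 0).
    by rewrite [tag _](y0 : tag (sval (sval y)) = 0).
  + suff /injfunPex[f0] : exists2 f0 : nat -> {x | C x},
        set_fun [set: nat] (Defs.pred_set (@structure_of (subtree C)
          (inhabits (s (beth_pt m)))) (RSort 0 : rsym tree_language)) f0 &
        set_inj [set: nat] f0 by exact: inj_card_le.
    exists s0; first by move=> b _; exact: s0P.
    by move=> b b' _ _ /s0_inj.
Qed.

Theorem theorem3p10 (n : nat) :
  exists (L : language) (P : rsym L) (T : theory L),
    [/\ countable_language L,
        rarity P = 1,
        complete_theory T &
        dependent T] /\
    (forall m : nat, m < n ->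
       exists M : structure L, two_cardinal_model T P (beth m) nat M) /\
    ~ (exists M : structure L, two_cardinal_model T P beth_omega nat M).
Proof.
exists tree_language, (RSort 0), (tree_theory n); split.
  split=> //; first exact: countable_tree_language.
  - have [M [/model_tree_theory Mt _ _]] := tree_two_cardinal (leq0n n).
    exact: complete_tree_theory Mt.
  - exact: dependent_tree_theory.
split=> [m /ltnW|[M]]; first exact: tree_two_cardinal.
exact: no_beth_omega_model.
Qed.
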